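(* Let $\psi$ be a colouring. The following are equivalent. (i) $\psi$ is regular. (ii) $U_h(\psi)$ is a formal deformation of the $\mathbb k$-algebra $U(\mathfrak{sl}_2)$: it is topologically free, and $U_h(\psi)/hU_h(\psi)\cong U(\mathfrak{sl}_2)$ as $\mathbb k$-algebras. (iii) $U_h(\psi)$ is a formal deformation of the $\mathfrak a$-algebra $U(\mathfrak{sl}_2)$: it is topologically free, and $U_h(\psi)/hU_h(\psi)\cong U(\mathfrak{sl}_2)$ as $\mathfrak a$-algebras.
   Context: $\mathbb k$ is a field of characteristic zero, and $\mathbb k[[h]]$ is the ring of formal power series over $\mathbb k$. For a $\mathbb k$-vector space $V_0$, $V_0[[h]]$ denotes the module of formal series $\sum_{m\ge0}v_mh^m$ with $v_m\in V_0$. A $\mathbb k[[h]]$-module is topologically free if it is isomorphic to some $V_0[[h]]$. $\mathfrak a$ is the Lie algebra over $\mathbb k$ generated by $H,X^-,X^+$ subject to $[H,X^\pm]=\pm2X^\pm$. An $\mathfrak a$-algebra is an algebra with a structural homomorphism from $U(\mathfrak a)$. $U(\mathfrak{sl}_2)$ is an $\mathfrak a$-algebra via the canonical projection sending $H,X^\pm$ to the Chevalley generators. We set $U_h(\mathfrak a):=U(\mathfrak a)[[h]]$. A $U_h(\mathfrak a)$-algebra $A$ makes $A/hA$ an $\mathfrak a$-algebra, via $U_h(\mathfrak a)/hU_h(\mathfrak a)\cong U(\mathfrak a)$. A colouring is a sequence $\psi=(\psi^k)_{k\ge1}$ of functions $\psi^k:\mathbb Z\to\mathbb k[[h]]$ satisfying: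 - (C1) $\psi^k(n)\equiv k(n-k+1)\bmod h$; - (C2) $\psi^{n+1}(n)=0$ for all $n\ge0$; - (C3) $\psi^{n+k+1}(n)=\psi^k(-n-2)$ for all $k\ge1$ and all $n\ge0$. Write $\psi^k(n)=\sum_m\psi^k_m(n)h^m$. The colouring $\psi$ is regular if, for every $m\ge0$, there is a polynomial $P_m\in\mathbb k[x,y]$ with $\psi^k_m(n)=P_m(k,n)$ for all $k\ge1$ and $n\in\mathbb Z$. $V_h(n,\psi)$ is the representation of $U_h(\mathfrak a)$ on $(\bigoplus_{k\ge0}\mathbb k b_k)[[h]]$ with the following action: - $H.b_k=(n-2k)b_k$; - $X^-.b_k=b_{k+1}$; - $X^+.b_0=0$, and $X^+.b_k=\psi^k(n)b_{k-1}$ for $k\ge1$. $U_h(\psi)$ is the quotient of $U_h(\mathfrak a)$ by the two-sided ideal of elements that act by zero on $V_h(n,\psi)$ for every $n\in\mathbb Z$. It is a $U_h(\mathfrak a)$-algebra via the projection map. *)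

(* Defs.v *)
From HB Require Import structures.
From mathcomp Require Import all_boot all_order all_algebra.
Set Implicit Arguments. Unset Strict Implicit. Unset Printing Implicit Defensive.
Import Order.TTheory GRing.Theory Num.Theory.
Local Open Scope ring_scope.

Section Defs.
Variable k : fieldType.

(* ---------- k[[h]] : a formal series sum_m f m h^m is f : nat -> k ---------- *)
Definition pser := nat -> k.
Definition psC (c : k) : pser := fun m => if m is 0 then c else 0.
Definition psmul (f g : pser) : pser :=
  fun m => \sum_(i < m.+1) f i * g (m - i)%N.

(* psi c n = psi^c(n); the value at c = 0 is irrelevant and never used. *)
Definition colouring (psi : nat -> int -> pser) : Prop :=
  [/\ (* (C1) *) forall (c : nat) (n : int), (1 <= c)%N ->
         psi c n 0%N = ((c%:Z * (n - c%:Z + 1))%R)%:~R,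
      (* (C2) *) forall n : nat, forall m, psi n.+1 n%:Z m = 0
    & (* (C3) *) forall (c n : nat), (1 <= c)%N ->
         forall m, psi (n + c + 1)%N n%:Z m = psi c (- n%:Z - 2) m].

Definition peval2 (P : {poly {poly k}}) (x y : k) : k := (P.[y%:P]).[x].

Definition regular (psi : nat -> int -> pser) : Prop :=
  forall m : nat, exists P : {poly {poly k}},
    forall (c : nat) (n : int), (1 <= c)%N -> psi c n m = peval2 P c%:R n%:~R.

Inductive gen := GH | GXm | GXp.
Definition gen_to_nat g := match g with GH => 0%N | GXm => 1%N | GXp => 2%N end.
Definition nat_to_gen n := match n with 0%N => GH | 1%N => GXm | _ => GXp end.
Lemma gen_natK : cancel gen_to_nat nat_to_gen. Proof. by case. Qed.
HB.instance Definition _ := Equality.copy gen (can_type gen_natK).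

(* An element of the free algebra k<H,X^-,X^+> is a formal linear combination
   of words (a word [:: a1; ...; ar] denotes the product a1 * ... * ar);
   an element of k<H,X^-,X^+>[[h]] is a sequence of such (coefficient of h^m).
   Two representatives are identified when their word coefficients agree. *)
Definition Fel := seq (k * seq gen).
Definition Fh := nat -> Fel.

Definition Fcoef (x : Fel) (w : seq gen) : k := \sum_(p <- x | p.2 == w) p.1.

Definition Fh_add (x y : Fh) : Fh := fun m => x m ++ y m.
Definition Fh_opp (x : Fh) : Fh := fun m => [seq (- p.1, p.2) | p <- x m].
Definition Fh_scale (c : k) (x : Fh) : Fh := fun m => [seq (c * p.1, p.2) | p <- x m].
Definition Fh_one : Fh := fun m => if m is 0 then [:: (1, [::])] else [::].
Definition Fh_mul (x y : Fh) : Fh := fun m =>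
  flatten [seq [seq (a.1 * b.1, a.2 ++ b.2) | a <- x i, b <- y (m - i)%N]
          | i <- iota 0 m.+1].
Definition Fh_psmul (f : pser) (x : Fh) : Fh := fun m =>
  flatten [seq [seq (f i * a.1, a.2) | a <- x (m - i)%N] | i <- iota 0 m.+1].
Definition Fh_gen (g : gen) : Fh := fun m => if m is 0 then [:: (1, [:: g])] else [::].
Definition in_hFh (x : Fh) : Prop := forall w, Fcoef (x 0%N) w = 0.

(* A generator sends b_j to (series coefficient) * b_i; we return (coef, i). *)
Definition gen_act (psi : nat -> int -> pser) (n : int) (g : gen) (j : nat)
  : pser * nat :=
  match g with
  | GH => (psC ((n - 2 * j%:Z)%R)%:~R, j)
  | GXm => (psC 1, j.+1)
  | GXp => if j is j'.+1 then (psi j n, j') else (psC 0, 0%N)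
  end.

Fixpoint word_act (psi : nat -> int -> pser) (n : int) (w : seq gen) (j : nat)
  : pser * nat :=
  match w with
  | [::] => (psC 1, j)
  | a :: w' => let: (c, i) := word_act psi n w' j in
               let: (c', i') := gen_act psi n a i in (psmul c' c, i')
  end.

(* coefficient of h^p b_i in x . b_j, for x in k<H,X^-,X^+>[[h]] acting on V_h(n,psi) *)
Definition act_basis (psi : nat -> int -> pser) (n : int) (x : Fh) (j p i : nat) : k :=
  \sum_(m < p.+1) \sum_(a <- x m)
     let: (c, t) := word_act psi n a.2 j in
     if t == i then a.1 * c (p - m)%N else 0.

(* x acts by zero on V_h(n,psi) for every integer n: x lies in the kernel of
   U_h(a) -> U_h(psi) *)
Definition annih (psi : nat -> int -> pser) (x : Fh) : Prop :=
  forall (n : int) (j p i : nat), act_basis psi n x j p i = 0.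

(* U_h(psi) = U_h / annih is topologically free: there is a k-vector space V0
   and a k[[h]]-linear isomorphism U_h(psi) ~ V0[[h]], i.e. a k[[h]]-linear
   surjection U_h -> V0[[h]] whose kernel is exactly the annihilator. *)
Definition topologically_free_Uhpsi (psi : nat -> int -> pser) : Prop :=
  exists (V0 : lmodType k) (Phi : Fh -> nat -> V0),
  [/\ forall x y m, Phi (Fh_add x y) m = Phi x m + Phi y m,
      forall (f : pser) x m, Phi (Fh_psmul f x) m = \sum_(i < m.+1) f i *: Phi x (m - i)%N,
      forall v : nat -> V0, exists x, forall m, Phi x m = v m
    & forall x, (forall m, Phi x m = 0) <-> annih psi x].

Definition is_kalg_hom (A B : algType k) (phi : A -> B) : Prop :=
  [/\ forall x y, phi (x + y) = phi x + phi y,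
      forall (c : k) x, phi (c *: x) = c *: phi x,
      forall x y, phi (x * y) = phi x * phi y
    & phi 1 = 1].

Definition sl2_rel (B : algType k) (e f hh : B) : Prop :=
  [/\ hh * e - e * hh = 2%:R * e, hh * f - f * hh = - (2%:R * f)
    & e * f - f * e = hh].

Definition is_Usl2 (A : algType k) (e f hh : A) : Prop :=
  sl2_rel e f hh /\
  forall (B : algType k) (e' f' h' : B), sl2_rel e' f' h' ->
    (exists phi : A -> B, is_kalg_hom phi /\ [/\ phi e = e', phi f = f' & phi hh = h'])
    /\ (forall phi1 phi2 : A -> B, is_kalg_hom phi1 -> is_kalg_hom phi2 ->
          phi1 e = phi2 e -> phi1 f = phi2 f -> phi1 hh = phi2 hh ->
          forall a, phi1 a = phi2 a).

(* a map Phi : U_h -> A induces a k-algebra isomorphism U_h(psi)/hU_h(psi) ~ A: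
   it is a surjective k-algebra map with kernel exactly annih + h U_h. *)
Definition induces_iso_mod_h (psi : nat -> int -> pser) (A : algType k)
    (Phi : Fh -> A) : Prop :=
  [/\ forall x y, Phi (Fh_add x y) = Phi x + Phi y,
      forall (c : k) x, Phi (Fh_scale c x) = c *: Phi x,
      forall x y, Phi (Fh_mul x y) = Phi x * Phi y
    & Phi Fh_one = 1] /\
  ((forall a : A, exists x, Phi x = a) /\
   (forall x, Phi x = 0 <->
        exists y, annih psi y /\ in_hFh (Fh_add x (Fh_opp y)))).

Definition deformation_kalg (psi : nat -> int -> pser) (A : algType k) : Prop :=
  topologically_free_Uhpsi psi /\ exists Phi : Fh -> A, induces_iso_mod_h psi Phi.

(* (iii): formal deformation of the a-algebra U(sl_2): moreover the isomorphism
   intertwines the structure maps U(a) -> _, i.e. sends H, X^+, X^- to H, E, F. *)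
Definition deformation_aalg (psi : nat -> int -> pser) (A : algType k)
    (e f hh : A) : Prop :=
  topologically_free_Uhpsi psi /\ exists Phi : Fh -> A,
    [/\ induces_iso_mod_h psi Phi, Phi (Fh_gen GH) = hh,
        Phi (Fh_gen GXp) = e & Phi (Fh_gen GXm) = f].

End Defs.

(* Main.v *)
Require Import Defs.
From HB Require Import structures.
From mathcomp Require Import all_boot all_order all_algebra.
From mathcomp Require Import boolp ring zify.
Set Implicit Arguments. Unset Strict Implicit. Unset Printing Implicit Defensive.
Import GRing.Theory.
Local Open Scope ring_scope.

(** Write F for the free algebra on H, X^-, X^+, J for the kernel of F -> U(sl_2),
    K for the annihilator in F[[h]] and K0 for the ideal of F formed by the constant
    terms of K. The module F[[h]]/K is separated, complete and torsion-free, so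
    everything hinges on the equality K0 = J. The inclusion of K0 in J holds because
    U(sl_2) acts faithfully on its finite-dimensional simple modules V(n), which are
    quotients of the V_h(n, psi) mod h; and J is contained in K0 as soon as
    r = [X^+, X^-] - H lies in K0, because ordered words span F modulo the relations
    and are linearly independent in U(sl_2).

    If psi is regular, (C3) makes psi^j(n) mod every power of h a polynomial in the
    eigenvalues of H and of the classical X^- X^+; any h-series of such functions is,
    by successive approximation, the action of an element of F[[h]], and applying this
    to the action of r shows that r is in K0. Conversely, if y in K has constant term r,
    then the h^m-coefficient of psi^(j+1)(n) - psi^j(n) is expressed through the lower
    ones, and summation over j gives regularity by induction on m.

    Finally, an abstract isomorphism F/K0 = U(sl_2) composed with the projection
    F/K0 -> F/J is a surjective endomorphism of U(sl_2). The pull-back of V(n) along it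
    is again a simple module of dimension n + 1, hence isomorphic to V(n); so its kernel
    kills every V(n) and is zero, which gives K0 = J. *)

(** * The free algebra: linear extensions from words, and ordered words *)

Section FreeAlgebra.
Variable k : fieldType.
Implicit Types (x y z : Fel k) (w : seq gen) (g : gen) (a b c : k).

(** Word coefficients, evaluation in an algebra and coefficients of the action are all instances of
    this linear extension. *)
Definition lin (V : lmodType k) (G : seq gen -> V) x : V :=
  \sum_(p <- x) p.1 *: G p.2.
Definition Fopp x : Fel k := [seq (- p.1, p.2) | p <- x].
Definition Fscale c x : Fel k := [seq (c * p.1, p.2) | p <- x].
Definition Flmul g x : Fel k := [seq (p.1, g :: p.2) | p <- x].
Definition Frmul w x : Fel k := [seq (p.1, p.2 ++ w) | p <- x].
Definition Feq x y := forall w, Fcoef x w = Fcoef y w.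

Section Lin.
Variable V : lmodType k.
Implicit Type G : seq gen -> V.

Lemma lin_nil G : lin G [::] = 0. Proof. exact: big_nil. Qed.
Lemma lin_cons G p x : lin G (p :: x) = p.1 *: G p.2 + lin G x.
Proof. exact: big_cons. Qed.
Lemma lin_cat G x y : lin G (x ++ y) = lin G x + lin G y.
Proof. exact: big_cat. Qed.
Lemma lin_opp G x : lin G (Fopp x) = - lin G x.
Proof.
by rewrite /lin big_map -sumrN; apply: eq_bigr => p _ /=; rewrite scaleNr.
Qed.
Lemma lin_scale G c x : lin G (Fscale c x) = c *: lin G x.
Proof.
by rewrite /lin big_map scaler_sumr; apply: eq_bigr => p _ /=; rewrite scalerA.
Qed.
Lemma lin_lmul G g x : lin G (Flmul g x) = lin (fun w => G (g :: w)) x.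
Proof. by rewrite /lin big_map. Qed.
Lemma lin_rmul G w x : lin G (Frmul w x) = lin (fun u => G (u ++ w)) x.
Proof. by rewrite /lin big_map. Qed.
Lemma eq_lin G G' x : G =1 G' -> lin G x = lin G' x.
Proof. by move=> e; apply: eq_bigr => p _; rewrite e. Qed.

(** A representative may list a word several times; grouping equal words shows that a linear
    extension depends on the word coefficients only. *)
Lemma lin_coefE G x :
  lin G x = \sum_(w <- undup [seq p.2 | p <- x]) Fcoef x w *: G w.
Proof.
rewrite /lin /Fcoef.
under [RHS]eq_bigr do rewrite scaler_suml big_mkcond.
rewrite exchange_big /= big_seq_cond [RHS]big_seq_cond.
apply: eq_bigr => p /andP[px _]; rewrite (bigD1_seq p.2) ?undup_uniq //=; last first.
  by rewrite mem_undup map_f.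
by rewrite eqxx big1 ?addr0 // => w /negPf nw; rewrite eq_sym nw.
Qed.

Lemma lin_eq0 G x : (forall w, Fcoef x w *: G w = 0) -> lin G x = 0.
Proof. by move=> h; rewrite lin_coefE big1. Qed.

Lemma eq_lin_coef G G' x :
  (forall w, Fcoef x w *: G w = Fcoef x w *: G' w) -> lin G x = lin G' x.
Proof. by move=> h; rewrite !lin_coefE; apply: eq_bigr => w _. Qed.

Lemma lin_sum (I : Type) (r : seq I) (G : I -> seq gen -> V) x :
  lin (fun w => \sum_(i <- r) G i w) x = \sum_(i <- r) lin (G i) x.
Proof. by rewrite /lin exchange_big; apply: eq_bigr => p _; rewrite scaler_sumr. Qed.

End Lin.

Lemma FcoefE x w : Fcoef x w = lin (fun u => ((u == w)%:R : k^o)) x.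
Proof.
rewrite /Fcoef /lin big_mkcond; apply: eq_bigr => p _.
by case: eqP => _ /=; rewrite ?scaler0 // /GRing.scale /= mulr1.
Qed.

Lemma linMl (G : seq gen -> k^o) c x : lin (fun w => c * G w : k^o) x = c * lin G x.
Proof.
by rewrite /lin mulr_sumr; apply: eq_bigr => p _; rewrite /GRing.scale /= mulrCA.
Qed.

Lemma lin_map (V W : lmodType k) (L : V -> W) (G : seq gen -> V) x :
  {morph L : u v / u + v} -> (forall a v, L (a *: v) = a *: L v) ->
  L (lin G x) = lin (L \o G) x.
Proof.
move=> LD LZ; elim: x => [|p x IH]; last by rewrite !lin_cons LD LZ IH.
by rewrite !lin_nil -(scale0r 0) LZ scale0r.
Qed.

Lemma Feq_lin (V : lmodType k) (G : seq gen -> V) x y :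
  Feq x y -> lin G x = lin G y.
Proof.
move=> xy; apply/eqP; rewrite -subr_eq0 -lin_opp -lin_cat; apply/eqP/lin_eq0 => w.
by rewrite FcoefE lin_cat lin_opp -!FcoefE xy subrr scale0r.
Qed.

Lemma Fcoef_cat x y w : Fcoef (x ++ y) w = Fcoef x w + Fcoef y w.
Proof. by rewrite !FcoefE lin_cat. Qed.
Lemma Fcoef_opp x w : Fcoef (Fopp x) w = - Fcoef x w.
Proof. by rewrite !FcoefE lin_opp. Qed.
Lemma Fcoef_scale c x w : Fcoef (Fscale c x) w = c * Fcoef x w.
Proof. by rewrite !FcoefE lin_scale. Qed.
Lemma Fcoef_nil w : Fcoef ([::] : Fel k) w = 0.
Proof. by rewrite FcoefE lin_nil. Qed.
Lemma Fcoef_cons p x w : Fcoef (p :: x) w = p.1 * (p.2 == w)%:R + Fcoef x w.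
Proof. by rewrite !FcoefE lin_cons. Qed.
Definition FcoefD := (Fcoef_cat, Fcoef_opp, Fcoef_scale, Fcoef_cons, Fcoef_nil).

Lemma Feq_lmul g x y : Feq x y -> Feq (Flmul g x) (Flmul g y).
Proof. by move=> e w; rewrite !FcoefE !lin_lmul; apply: (@Feq_lin k^o). Qed.

Lemma Feq_rmul u x y : Feq x y -> Feq (Frmul u x) (Frmul u y).
Proof. by move=> e w; rewrite !FcoefE !lin_rmul; apply: (@Feq_lin k^o). Qed.

(** The ranks fix the Poincare-Birkhoff-Witt order X^- < H < X^+. *)
Definition grank g := match g with GXm => 0 | GH => 1 | GXp => 2 end%N.
Definition ordered w := sorted (fun g g' => (grank g <= grank g')%N) w.
Definition mono (a b c : nat) := nseq a GXm ++ nseq b GH ++ nseq c GXp.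
Definition NF x := all (fun p => ordered p.2) x.

Lemma orderedE w : ordered w ->
  w = mono (count_mem GXm w) (count_mem GH w) (count_mem GXp w).
Proof.
elim: w => //= g w IH h.
have {}IH : w = mono (count_mem GXm w) (count_mem GH w) (count_mem GXp w).
  by apply: IH; exact: path_sorted h.
move: h IH; rewrite /mono; case: g => /= h IH.
- have h0 : count_mem GXm w = 0%N.
    apply/count_memPn; apply/negP => hw.
    by have /allP/(_ _ hw) := order_path_min (fun _ _ _ => @leq_trans _ _ _) h.
  by rewrite {1}IH h0.
- by rewrite {1}IH.
- have h0 : count_mem GXm w = 0%N.
    apply/count_memPn; apply/negP => hw.
    by have /allP/(_ _ hw) := order_path_min (fun _ _ _ => @leq_trans _ _ _) h.
  have h1 : count_mem GH w = 0%N.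
    apply/count_memPn; apply/negP => hw.
    by have /allP/(_ _ hw) := order_path_min (fun _ _ _ => @leq_trans _ _ _) h.
  by rewrite {1}IH h0 h1.
Qed.

Lemma NF_coef x w : NF x -> ~~ ordered w -> Fcoef x w = 0.
Proof.
move=> /allP nx nw; rewrite /Fcoef big_seq_cond big1 // => p /andP[px /eqP pw].
by move: (nx _ px); rewrite pw (negPf nw).
Qed.

Lemma NF_cat x y : NF (x ++ y) = NF x && NF y. Proof. exact: all_cat. Qed.
Lemma NF_opp x : NF (Fopp x) = NF x. Proof. by rewrite /NF all_map. Qed.
Lemma NF_scale c x : NF (Fscale c x) = NF x. Proof. by rewrite /NF all_map. Qed.

(** The relations of U(sl_2) come already multiplied on the right by [w]; their left multiples are
    supplied by closure under [Flmul]. *)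
Definition rel_Hp w : Fel k :=
  [:: (1, GH :: GXp :: w); (-1, GXp :: GH :: w); (- 2%:R, GXp :: w)].
Definition rel_Hm w : Fel k :=
  [:: (1, GH :: GXm :: w); (-1, GXm :: GH :: w); (2%:R, GXm :: w)].
Definition rel_pm w : Fel k :=
  [:: (1, GXp :: GXm :: w); (-1, GXm :: GXp :: w); (- 1, GH :: w)].

(** * Straightening words into ordered ones *)

Section Straightening.
Variable I : Fel k -> Prop.
Hypothesis I_eq : forall x y, Feq x y -> I x -> I y.
Hypothesis I_cat : forall x y, I x -> I y -> I (x ++ y).
Hypothesis I_scale : forall c x, I x -> I (Fscale c x).
Hypothesis I_lmul : forall g x, I x -> I (Flmul g x).
Hypothesis I_Hp : forall w, I (rel_Hp w).
Hypothesis I_Hm : forall w, I (rel_Hm w).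
Hypothesis I_pm : forall w, I (rel_pm w).

Let N x := exists2 y, NF y & I (x ++ Fopp y).

Let I_nil : I [::].
Proof. by apply: I_eq (I_scale 0 (I_pm [::])) => w; rewrite FcoefD mul0r Fcoef_nil. Qed.

Let I_eq0 x : Feq x [::] -> I x.
Proof. by move=> h; apply: I_eq I_nil => w; rewrite h. Qed.

Let N_NF x : NF x -> N x.
Proof. by move=> nx; exists x => //; apply: I_eq0 => w; rewrite !FcoefD subrr. Qed.

Let N_I x : I x -> N x.
Proof. by move=> ix; exists [::] => //; rewrite cats0. Qed.

Let N_cat x y : N x -> N y -> N (x ++ y).
Proof.
move=> [x' nx ix] [y' ny iy]; exists (x' ++ y'); first by rewrite NF_cat nx.
by apply: I_eq (I_cat ix iy) => w; rewrite !FcoefD; ring.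
Qed.

Let N_scale c x : N x -> N (Fscale c x).
Proof.
move=> [x' nx ix]; exists (Fscale c x'); first by rewrite NF_scale.
by apply: I_eq (I_scale c ix) => w; rewrite !FcoefD; ring.
Qed.

Let N_eq x y : Feq x y -> N x -> N y.
Proof.
move=> e [x' nx ix]; exists x' => //.
by apply: I_eq ix => w; rewrite !FcoefD e.
Qed.

Let N_lmul g x : (forall w, ordered w -> N [:: (1, g :: w)]) -> N x -> N (Flmul g x).
Proof.
move=> h [y ny iy].
have : N (Flmul g y).
  elim: y ny {iy} => [|[c w] y IH] /=; first by move=> _; apply: N_NF.
  move=> /andP[ow /IH Ny]; apply: N_eq (N_cat (N_scale c (h _ ow)) Ny) => u.
  by rewrite !FcoefD /=; ring.
move=> /N_cat /(_ (N_I (I_lmul g iy))); apply: N_eq => u.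
by rewrite !FcoefD !FcoefE !lin_lmul lin_cat lin_opp; ring.
Qed.

Let step_m w : ordered w -> N [:: (1, GXm :: w)].
Proof. by move=> ow; apply: N_NF; rewrite /NF /= andbT /ordered /=; case: w ow. Qed.

(** Only H in front of X^- is out of order, and H X^- w = X^- H w - 2 X^- w moves it past; the
    induction is on the length of the word. *)
Let step_h w : ordered w -> N [:: (1, GH :: w)].
Proof.
elim: w => [|g w IH] ow; first exact: N_NF.
have /IH Nw : ordered w by exact: path_sorted ow.
case: g ow => ow.
- by apply: N_NF; rewrite /NF /= andbT.
- have Nm := N_lmul step_m.
  have ow' : ordered w by exact: path_sorted ow.
  have := N_cat (N_I (I_Hm w)) (N_cat (Nm _ Nw) (N_scale (- 2%:R) (step_m ow'))).
  by apply: N_eq => u; rewrite !FcoefD /=; ring.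
- by apply: N_NF; rewrite /NF /= andbT.
Qed.

(** Here X^+ H w = H X^+ w - 2 X^+ w and X^+ X^- w = X^- X^+ w + H w. The word X^+ w is straightened
    by induction, and the letter left in front is absorbed by [step_h] or [step_m]. *)
Let step_p w : ordered w -> N [:: (1, GXp :: w)].
Proof.
elim: w => [|g w IH] ow; first exact: N_NF.
have ow' : ordered w by exact: path_sorted ow.
have Nw := IH ow'.
case: g ow => ow.
- have := N_cat (N_scale (- 1) (N_I (I_Hp w)))
           (N_cat (N_lmul step_h Nw) (N_scale (- 2%:R) Nw)).
  by apply: N_eq => u; rewrite !FcoefD /=; ring.
- have := N_cat (N_I (I_pm w)) (N_cat (N_lmul step_m Nw) (step_h ow')).
  by apply: N_eq => u; rewrite !FcoefD /=; ring.
- by apply: N_NF; rewrite /NF /= andbT.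
Qed.

(** Serves both for the kernel of the evaluation in U(sl_2) and for [K0]. *)
Lemma straighten x : exists2 y, NF y & I (x ++ Fopp y).
Proof.
have Nw w : N [:: (1, w)].
  elim: w => [|g w IH]; first exact: N_NF.
  by apply: (N_lmul (x := [:: (1, w)])) => //; case: g.
elim: x => [|[c w] x IH]; first exact: N_NF.
by apply: N_eq (N_cat (N_scale c (Nw w)) IH) => u; rewrite !FcoefD /=; ring.
Qed.

End Straightening.
End FreeAlgebra.

(** * Coefficients of the action on V_h(n, psi), and the annihilator ideal *)

Section Action.
Variable k : fieldType.
Implicit Types (f h : pser k) (g : gen) (u w : seq gen) (n : int).

Lemma psmul0 f h : psmul f h 0 = f 0%N * h 0%N.
Proof. by rewrite /psmul big_ord1. Qed.

Lemma psmul_psCl a f l : psmul (psC a) f l = a * f l.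
Proof. by rewrite /psmul big_ord_recl big1 ?addr0 ?subn0 //= => i _; rewrite mul0r. Qed.

Lemma eq_psmul f f' (g g' : pser k) l : (forall i, (i <= l)%N -> f i = f' i) ->
  (forall i, (i <= l)%N -> g i = g' i) -> psmul f g l = psmul f' g' l.
Proof.
move=> ef eg; apply: eq_bigr => i _; rewrite ef ?eg ?leq_subr //.
by rewrite -ltnS.
Qed.

Lemma psmul_eq0l f (g : pser k) l : (forall i, f i = 0) -> psmul f g l = 0.
Proof. by move=> h; apply: big1 => i _; rewrite h mul0r. Qed.
Lemma psmul_eq0r f (g : pser k) l : (forall i, g i = 0) -> psmul f g l = 0.
Proof. by move=> h; apply: big1 => i _; rewrite h mulr0. Qed.

(** Up to a given order, series multiply like their polynomial truncations; this transfers
    associativity from polynomials. *)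
Lemma psmul_poly f (g : pser k) N l : (l < N)%N ->
  psmul f g l = ((\poly_(i < N) f i) * (\poly_(i < N) g i))`_l.
Proof.
move=> lN; rewrite coefM; apply: eq_bigr => i _; rewrite !coef_poly.
have il : (i <= l)%N by rewrite -ltnS.
by rewrite (leq_ltn_trans il lN) (leq_ltn_trans (leq_subr _ _) lN).
Qed.

Lemma psmulA f (g : pser k) h l : psmul f (psmul g h) l = psmul (psmul f g) h l.
Proof.
have hN i : (i <= l)%N -> (i < l.+1)%N by [].
rewrite (@eq_psmul f f _ (fun i => (\poly_(i < l.+1) g i * \poly_(i < l.+1) h i)`_i)) //;
  last by move=> i /hN; apply: psmul_poly.
rewrite (@eq_psmul (psmul f g) (fun i => (\poly_(i < l.+1) f i * \poly_(i < l.+1) g i)`_i) h h) //;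
  last by move=> i /hN; apply: psmul_poly.
transitivity ((\poly_(i < l.+1) f i * (\poly_(i < l.+1) g i * \poly_(i < l.+1) h i))`_l).
  rewrite coefM; apply: eq_bigr => i _; congr (_ * _).
  by rewrite coef_poly ltn_ord.
rewrite mulrA coefM; apply: eq_bigr => i _; congr (_ * _).
by rewrite coef_poly ltnS leq_subr.
Qed.

Lemma sum_triangle (p : nat) (F : nat -> nat -> k) :
  \sum_(m < p.+1) \sum_(s < (p - m).+1) F m s =
  \sum_(s < p.+1) \sum_(m < (p - s).+1) F m s.
Proof.
have h (G : nat -> nat -> k) : \sum_(m < p.+1) \sum_(s < (p - m).+1) G m s =
    \sum_(m < p.+1) \sum_(s < p.+1 | (m + s <= p)%N) G m s.
  apply: eq_bigr => m _; rewrite (big_ord_widen p.+1) ?ltnS ?leq_subr //.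
  by apply: eq_bigl => s; have := ltn_ord m; lia.
rewrite h (exchange_big_dep xpredT) //= (h (fun s m => F m s)).
by apply: eq_bigr => s _; apply: eq_bigl => m; rewrite addnC.
Qed.

Variable psi : nat -> int -> pser k.

(** The convention psi^0 = 0 encodes X^+ b_0 = 0 and agrees with the formula of (C1) at index 0. *)
Definition psi0 (j : nat) n l : k := if j is 0 then 0 else psi j n l.

(* The coefficient of h^l b_i in w . b_j. *)
Definition Wc n w (j i l : nat) : k^o :=
  if (word_act psi n w j).2 == i then (word_act psi n w j).1 l else 0.

Lemma word_act_cons2 n g w j :
  (word_act psi n (g :: w) j).2 = (gen_act psi n g (word_act psi n w j).2).2.
Proof. by rewrite /=; case: word_act => c i /=; case: gen_act. Qed.

Lemma word_act_cons1 n g w j :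
  (word_act psi n (g :: w) j).1 =
  psmul (gen_act psi n g (word_act psi n w j).2).1 (word_act psi n w j).1.
Proof. by rewrite /=; case: word_act => c i /=; case: gen_act. Qed.

Lemma word_act_cat2 n u w j :
  (word_act psi n (u ++ w) j).2 = (word_act psi n u (word_act psi n w j).2).2.
Proof. by elim: u => // g u IH; rewrite cat_cons !word_act_cons2 IH. Qed.

Lemma word_act_cat1 n u w j l : (word_act psi n (u ++ w) j).1 l =
  psmul (word_act psi n u (word_act psi n w j).2).1 (word_act psi n w j).1 l.
Proof.
elim: u l => [|g u IH] l; first by rewrite /= psmul_psCl mul1r.
rewrite cat_cons !word_act_cons1 word_act_cat2 -psmulA.
by apply: eq_psmul => // i _.
Qed.

Lemma gen_act_Xp1 n j l : (gen_act psi n GXp j).1 l = psi0 j n l.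
Proof. by case: j => //=; case: l. Qed.
Lemma gen_act_Xp2 n j : (gen_act psi n GXp j).2 = j.-1.
Proof. by case: j. Qed.

(** The action read from its target: a generator reaches b_i with nonzero coefficient from at most
    one basis vector. For X^- and i = 0 there is none, whence the zero series; X^+ nominally sends
    b_0 to b_0, with coefficient zero. *)
Lemma gen_act_src n g i : exists src (cf : pser k), forall t l,
  (if (gen_act psi n g t).2 == i then (gen_act psi n g t).1 l else 0) =
  (if t == src then cf l else 0).
Proof.
case: g.
- exists i, (psC ((n - 2 * i%:Z)%:~R)) => t l /=; by case: eqP => // ->.
- case: i => [|i]; first by exists 0%N, (fun=> 0) => t l /=; rewrite if_same.
  by exists i, (psC 1) => t l /=; rewrite eqSS.
- exists i.+1, (psi i.+1 n) => t l; rewrite gen_act_Xp1 gen_act_Xp2.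
  case: t => [|t] /=; first by rewrite if_same.
  by rewrite eqSS; case: eqP => // ->.
Qed.

Lemma Wc_cons n g i : exists src (cf : pser k), forall w j l,
  Wc n (g :: w) j i l = \sum_(s < l.+1) cf s * Wc n w j src (l - s).
Proof.
have [src [cf h]] := gen_act_src n g i.
exists src, cf => w j l; rewrite /Wc word_act_cons1 word_act_cons2 /psmul.
under [RHS]eq_bigr => s _.
  have -> : cf s * (if (word_act psi n w j).2 == src then (word_act psi n w j).1 (l - s)%N else 0)
    = (if (word_act psi n w j).2 == src then cf s else 0) * (word_act psi n w j).1 (l - s)%N.
    by case: eqP; rewrite ?mulr0 ?mul0r.
  rewrite -h; over.
case: eqP => // _; rewrite big1 // => s _; by rewrite mul0r.
Qed.

Lemma Wc_cat n u w j i l : Wc n (u ++ w) j i l =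
  \sum_(s < l.+1) (word_act psi n w j).1 s * Wc n u (word_act psi n w j).2 i (l - s).
Proof.
rewrite /Wc word_act_cat2 word_act_cat1; case: eqP => _; last first.
  by rewrite big1 // => s _; rewrite mulr0.
rewrite /psmul (reindex_inj rev_ord_inj) /=; apply: eq_bigr => s _.
have sl : (s <= l)%N by rewrite -ltnS.
by rewrite subSS subKn // mulrC.
Qed.

Definition actL n j i l (x : Fel k) : k := lin (fun w => Wc n w j i l) x.

Lemma act_basisE n x j p i :
  act_basis psi n x j p i = \sum_(m < p.+1) actL n j i (p - m)%N (x m).
Proof.
apply: eq_bigr => m _; apply: eq_bigr => a _; rewrite /Wc.
case: word_act => c t /=; case: eqP => _; by rewrite ?scaler0.
Qed.

Lemma actL_cat n j i l x y : actL n j i l (x ++ y) = actL n j i l x + actL n j i l y.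
Proof. by rewrite /actL lin_cat. Qed.
Lemma actL_opp n j i l x : actL n j i l (Fopp x) = - actL n j i l x.
Proof. by rewrite /actL lin_opp. Qed.
Lemma actL_scale n j i l c x : actL n j i l (Fscale c x) = c * actL n j i l x.
Proof. by rewrite /actL lin_scale. Qed.
Lemma actL_eq n j i l x y : Feq x y -> actL n j i l x = actL n j i l y.
Proof. exact: (@Feq_lin k k^o). Qed.
Lemma actL_nil n j i l : actL n j i l [::] = 0.
Proof. by rewrite /actL lin_nil. Qed.

Lemma actL_lmul n g i : exists src (cf : pser k), forall x j l,
  actL n j i l (Flmul g x) = \sum_(s < l.+1) cf s * actL n j src (l - s)%N x.
Proof.
have [src [cf h]] := Wc_cons n g i; exists src, cf => x j l.
rewrite /actL lin_lmul (eq_lin _ (fun w => h w j l)).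
rewrite (@lin_sum k k^o 'I_l.+1 _ (fun s w => cf s * Wc n w j src (l - s)%N)).
by apply: eq_bigr => s _; rewrite linMl.
Qed.

Lemma actL_rmul n w x j i l : actL n j i l (Frmul w x) =
  \sum_(s < l.+1) (word_act psi n w j).1 s * actL n (word_act psi n w j).2 i (l - s)%N x.
Proof.
rewrite /actL lin_rmul (eq_lin _ (fun u => Wc_cat n u w j i l)).
rewrite (@lin_sum k k^o 'I_l.+1 _
  (fun s u => (word_act psi n w j).1 s * Wc n u (word_act psi n w j).2 i (l - s)%N)).
by apply: eq_bigr => s _; rewrite linMl.
Qed.

Implicit Types (x y : Fh k).

Lemma eq_annih x y : (forall m, Feq (x m) (y m)) -> annih psi x -> annih psi y.
Proof.
move=> e ax n j p i; rewrite -(ax n j p i) !act_basisE; apply: eq_bigr => m _.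
by apply: actL_eq => w; rewrite e.
Qed.

Lemma annih_add x y : annih psi x -> annih psi y -> annih psi (Fh_add x y).
Proof.
move=> ax ay n j p i; rewrite act_basisE.
under eq_bigr do rewrite actL_cat.
by rewrite big_split /= -!act_basisE ax ay addr0.
Qed.

Lemma annih_scale c x : annih psi x -> annih psi (Fh_scale c x).
Proof.
move=> ax n j p i; rewrite act_basisE.
under eq_bigr do rewrite (actL_scale _ _ _ _ c).
by rewrite -mulr_sumr -act_basisE ax mulr0.
Qed.

Lemma annih_opp x : annih psi x -> annih psi (Fh_opp x).
Proof.
move=> /(annih_scale (-1)); apply: eq_annih => m w.
by rewrite (Fcoef_scale (-1) (x m)) (Fcoef_opp (x m)) mulN1r.
Qed.

(** A coefficient of g x b_j is a fixed series times the coefficients of x b_j at a single source;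
    once the two sums are exchanged, each inner sum is a coefficient of the action of x. *)
Lemma annih_lmul g x : annih psi x -> annih psi (fun m => Flmul g (x m)).
Proof.
move=> ax n j p i; rewrite act_basisE; have [src [cf h]] := actL_lmul n g i.
under eq_bigr => m _ do rewrite h.
rewrite (sum_triangle p (fun m s => cf s * actL n j src (p - m - s)%N (x m))).
rewrite big1 // => s _; rewrite -mulr_sumr.
under eq_bigr do rewrite subnAC.
by rewrite -act_basisE ax mulr0.
Qed.

Lemma annih_rmul w x : annih psi x -> annih psi (fun m => Frmul w (x m)).
Proof.
move=> ax n j p i; rewrite act_basisE.
under eq_bigr => m _ do rewrite actL_rmul.
rewrite (sum_triangle p (fun m s => (word_act psi n w j).1 s *
   actL n (word_act psi n w j).2 i (p - m - s)%N (x m))).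
rewrite big1 // => s _; rewrite -mulr_sumr.
under eq_bigr do rewrite subnAC.
by rewrite -act_basisE ax mulr0.
Qed.

(** Multiplication by h. *)
Definition Fh_shift x : Fh k := fun m => if m is m'.+1 then x m' else [::].
Definition Fh_const (x : Fel k) : Fh k := fun m => if m is 0 then x else [::].

Lemma act_shift n x j p i : act_basis psi n (Fh_shift x) j p i =
  if p is p'.+1 then act_basis psi n x j p' i else 0.
Proof.
rewrite act_basisE big_ord_recl /= actL_nil add0r.
by case: p => [|p]; rewrite ?big_ord0 // act_basisE; apply: eq_bigr.
Qed.

Lemma act_const n (x : Fel k) j p i : act_basis psi n (Fh_const x) j p i = actL n j i p x.
Proof.
by rewrite act_basisE big_ord_recl subn0 big1 ?addr0 // => m _; rewrite actL_nil.
Qed.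

Lemma act_add n x y j p i : act_basis psi n (Fh_add x y) j p i =
  act_basis psi n x j p i + act_basis psi n y j p i.
Proof.
rewrite !act_basisE -big_split /=; apply: eq_bigr => m _; exact: actL_cat.
Qed.

Lemma act_opp n x j p i : act_basis psi n (Fh_opp x) j p i = - act_basis psi n x j p i.
Proof.
rewrite !act_basisE -sumrN; apply: eq_bigr => m _; exact: actL_opp.
Qed.

Lemma act_scale n c x j p i : act_basis psi n (Fh_scale c x) j p i = c * act_basis psi n x j p i.
Proof.
rewrite !act_basisE mulr_sumr; apply: eq_bigr => m _; exact: actL_scale.
Qed.

Lemma act_eq n x y j p i : (forall m, Feq (x m) (y m)) ->
  act_basis psi n x j p i = act_basis psi n y j p i.
Proof.
move=> e; rewrite !act_basisE; apply: eq_bigr => m _; exact: actL_eq.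
Qed.

Lemma Fcoef_psmul f x m w :
  Fcoef (Fh_psmul f x m) w = \sum_(i < m.+1) f i * Fcoef (x (m - i)%N) w.
Proof.
rewrite /Fh_psmul /Fcoef big_flatten big_map.
rewrite (_ : iota 0 m.+1 = index_iota 0 m.+1) ?big_mkord; last by rewrite /index_iota subn0.
by apply: eq_bigr => i _; rewrite big_map -mulr_sumr.
Qed.

(** Write f x = f_0 x + h f' x with f' = (f - f_0) / h; the factor h lowers the order p, on which
    the induction runs. *)
Lemma annih_psmul f x : annih psi x -> annih psi (Fh_psmul f x).
Proof.
move=> ax n j p i; elim: p f => [|p IH] f;
  rewrite (@act_eq _ _ (Fh_add (Fh_scale (f 0%N) x)
     (Fh_shift (Fh_psmul (fun l => f l.+1) x)))) ?act_add ?act_scale ?act_shift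
     ?ax ?IH ?mulr0 ?addr0 //.
all: move=> m w; rewrite Fcoef_psmul big_ord_recl subn0 (Fcoef_cat (Fh_scale _ _ m));
  rewrite (Fcoef_scale _ (x m)); congr (_ + _).
all: case: m => [|m]; rewrite ?big_ord0 ?Fcoef_nil // (Fcoef_psmul _ _ m).
all: by apply: eq_bigr.
Qed.

Definition K0 (x : Fel k) := exists2 y, annih psi y & Feq (y 0%N) x.

Lemma K0_eq (x y : Fel k) : Feq x y -> K0 x -> K0 y.
Proof. by move=> e [z az zx]; exists z => // w; rewrite zx e. Qed.
Lemma K0_cat (x y : Fel k) : K0 x -> K0 y -> K0 (x ++ y).
Proof.
move=> [x' ax ex] [y' ay ey]; exists (Fh_add x' y'); first exact: annih_add.
by move=> w; rewrite !Fcoef_cat ex ey.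
Qed.
Lemma K0_scale c (x : Fel k) : K0 x -> K0 (Fscale c x).
Proof.
move=> [x' ax ex]; exists (Fh_scale c x'); first exact: annih_scale.
by move=> w; rewrite !Fcoef_scale ex.
Qed.
Lemma K0_lmul g (x : Fel k) : K0 x -> K0 (Flmul g x).
Proof.
move=> [x' ax ex]; exists (fun m => Flmul g (x' m)); first exact: annih_lmul.
exact: Feq_lmul.
Qed.
Lemma K0_rmul w (x : Fel k) : K0 x -> K0 (Frmul w x).
Proof.
move=> [x' ax ex]; exists (fun m => Frmul w (x' m)); first exact: annih_rmul.
exact: Feq_rmul.
Qed.

Lemma K0_actL (x : Fel k) : (forall n j i l, actL n j i l x = 0) -> K0 x.
Proof. by move=> h; exists (Fh_const x) => // n j p i; rewrite act_const. Qed.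

Lemma psmul_scale f c (g : pser k) l : psmul f (fun i => c * g i) l = c * psmul f g l.
Proof. by rewrite /psmul mulr_sumr; apply: eq_bigr => i _; rewrite mulrCA. Qed.

Lemma word_act_H n w j l : (word_act psi n (GH :: w) j).1 l =
  (n - 2 * (word_act psi n w j).2%:Z)%:~R * (word_act psi n w j).1 l.
Proof. by rewrite word_act_cons1 psmul_psCl. Qed.

Lemma word_act_H2 n w j :
  (word_act psi n (GH :: w) j).2 = (word_act psi n w j).2.
Proof. by rewrite word_act_cons2. Qed.
Lemma word_act_Xp1 n w j l : (word_act psi n (GXp :: w) j).1 l =
  psmul (psi0 (word_act psi n w j).2 n) (word_act psi n w j).1 l.
Proof. by rewrite word_act_cons1; apply: eq_psmul => // i _; rewrite gen_act_Xp1. Qed.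
Lemma word_act_Xp2 n w j :
  (word_act psi n (GXp :: w) j).2 = (word_act psi n w j).2.-1.
Proof. by rewrite word_act_cons2 gen_act_Xp2. Qed.
Lemma word_act_Xm1 n w j l :
  (word_act psi n (GXm :: w) j).1 l = (word_act psi n w j).1 l.
Proof. by rewrite word_act_cons1 psmul_psCl mul1r. Qed.
Lemma word_act_Xm2 n w j :
  (word_act psi n (GXm :: w) j).2 = (word_act psi n w j).2.+1.
Proof. by rewrite word_act_cons2. Qed.

(** This relation and [rel_Hm] only express weights, which psi does not affect; they hold exactly on
    V_h(n, psi), so the constant series annihilates. *)
Lemma K0_Hp w : K0 (rel_Hp k w).
Proof.
apply: K0_actL => n j i l; rewrite /actL /rel_Hp !lin_cons lin_nil addr0.
rewrite /Wc !(word_act_H, word_act_H2, word_act_Xp2, word_act_Xp1).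
set t := (word_act psi n w j).2; set c := (word_act psi n w j).1.
rewrite (eq_psmul (l := l) (f' := psi0 t n)
  (g := (word_act psi n (GH :: w) j).1) (g' := fun l => (n - 2 * t%:Z)%:~R * c l)) //;
  last by move=> l' _; exact: word_act_H.
rewrite psmul_scale.
(* At t = 0 the truncated [t.-1] differs from t - 1, but the coefficient of X^+ vanishes there. *)
case: eqP => _; last by rewrite !scaler0 !addr0.
have [->|t0] := posnP t.
  by rewrite psmul_eq0l // !mulr0 !scaler0 !addr0.
have -> : t%:Z = t.-1%:Z + 1 by lia.
rewrite /GRing.scale /= !(rmorphB, rmorphM, rmorphD, rmorph1) /=; ring.
Qed.

Lemma K0_Hm w : K0 (rel_Hm k w).
Proof.
apply: K0_actL => n j i l; rewrite /actL /rel_Hm !lin_cons lin_nil addr0.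
rewrite /Wc !(word_act_H, word_act_H2, word_act_Xm2, word_act_Xm1).
case: eqP => _; last by rewrite !scaler0 !addr0.
have -> : ((word_act psi n w j).2).+1%:Z = ((word_act psi n w j).2)%:Z + 1 by lia.
rewrite /GRing.scale /= !(rmorphB, rmorphM, rmorphD, rmorph1) /=; ring.
Qed.

End Action.

(** * Elementary properties of algebra homomorphisms *)

Section KalgHom.
Variables (k : fieldType) (A B : algType k) (phi : A -> B).
Hypothesis hphi : is_kalg_hom phi.

Lemma khomD x y : phi (x + y) = phi x + phi y. Proof. by case: hphi. Qed.
Lemma khomZ (c : k) x : phi (c *: x) = c *: phi x. Proof. by case: hphi. Qed.
Lemma khomM x y : phi (x * y) = phi x * phi y. Proof. by case: hphi. Qed.
Lemma khom1 : phi 1 = 1. Proof. by case: hphi. Qed.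
Lemma khom0 : phi 0 = 0. Proof. by rewrite -(scale0r 0) khomZ scale0r. Qed.
Lemma khomN x : phi (- x) = - phi x. Proof. by rewrite -scaleN1r khomZ scaleN1r. Qed.
Lemma khomX x n : phi (x ^+ n) = phi x ^+ n.
Proof. by elim: n => [|n IH]; rewrite ?khom1 // !exprS khomM IH. Qed.
Lemma khom_nat n : phi n%:R = n%:R.
Proof. by elim: n => [|n IH]; rewrite ?khom0 // mulrS khomD khom1 IH -mulrS. Qed.
Lemma khom_prod (I : Type) (r : seq I) (F : I -> A) :
  phi (\prod_(i <- r) F i) = \prod_(i <- r) phi (F i).
Proof. by elim: r => [|i r IH]; rewrite ?big_nil ?khom1 // !big_cons khomM IH. Qed.
Lemma khom_lin (G : seq gen -> A) x : phi (lin G x) = lin (phi \o G) x.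
Proof.
by elim: x => [|p x IH]; rewrite ?lin_nil ?khom0 // !lin_cons khomD khomZ IH.
Qed.
End KalgHom.

(** * Evaluation of the free algebra in U(sl_2) *)

Section Evaluation.
Variables (k : fieldType) (A : algType k) (e f hh : A).

Definition gA g := match g with GH => hh | GXm => f | GXp => e end.
Definition wA (w : seq gen) : A := \prod_(g <- w) gA g.
Definition ev (x : Fel k) : A := lin wA x.
Definition Fmul (x y : Fel k) : Fel k :=
  [seq (a.1 * b.1, a.2 ++ b.2) | a <- x, b <- y].

Lemma wA_cons g w : wA (g :: w) = gA g * wA w. Proof. exact: big_cons. Qed.

Lemma ev_mul x y : ev (Fmul x y) = ev x * ev y.
Proof.
rewrite /ev /lin /Fmul big_allpairs_dep /= mulr_suml; apply: eq_bigr => p _.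
rewrite mulr_sumr; apply: eq_bigr => q _.
by rewrite /wA big_cat /= -scalerAr -scalerAl scalerA mulrC.
Qed.

Lemma ev_one : ev [:: (1, [::])] = 1.
Proof. by rewrite /ev lin_cons lin_nil addr0 scale1r /wA big_nil. Qed.

Lemma ev_gen g : ev [:: (1, [:: g])] = gA g.
Proof. by rewrite /ev lin_cons lin_nil addr0 scale1r /wA big_seq1. Qed.

Definition genS : {pred A} := fun a => `[< exists x, ev x = a >].

Lemma genS_subalg : subalg_closed genS.
Proof.
split.
- by apply/asboolP; exists [:: (1, [::])]; exact: ev_one.
- move=> c u v /asboolP[x <-] /asboolP[y <-]; apply/asboolP.
  by exists (Fscale c x ++ y); rewrite /ev lin_cat lin_scale.
- move=> u v /asboolP[x <-] /asboolP[y <-]; apply/asboolP.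
  by exists (Fmul x y); rewrite ev_mul.
Qed.

HB.instance Definition _ := GRing.isSubalgClosed.Build k A genS genS_subalg.

Record genT := GenT { gen_val :> A; gen_valP : gen_val \in genS }.
HB.instance Definition _ := [isSub for gen_val].
HB.instance Definition _ := [Choice of genT by <:].
HB.instance Definition _ := [SubChoice_isSubAlgebra of genT by <:].

Hypothesis hA : is_Usl2 e f hh.

(** The universal property maps A to the subalgebra [genT] of values of [ev]; followed by the
    inclusion, this map fixes the generators, so by uniqueness it is the identity of A. *)
Lemma ev_surj a : exists x, ev x = a.
Proof.
have gP g : gA g \in genS by apply/asboolP; exists [:: (1, [:: g])]; exact: ev_gen.
pose i (b : genT) : A := val b.
have hi : is_kalg_hom i by split.
have [[r1 r2 r3] univ] := hA.
pose e' := GenT (gP GXp); pose f' := GenT (gP GXm); pose h' := GenT (gP GH).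
have rel : sl2_rel e' f' h'.
  have v2 : val (2%:R : genT) = 2%:R by rewrite rmorph_nat.
  by split; apply: val_inj; rewrite /= ?(rmorphB, rmorphN, rmorphM) /= ?v2.
have [[phi [hphi [pe pf ph]]] _] := univ genT e' f' h' rel.
have [_ /(_ (i \o phi) id)] := univ A e f hh (And3 r1 r2 r3).
have hip : is_kalg_hom (i \o phi).
  split=> *; rewrite /= ?(khomD hphi) ?(khomZ hphi) ?(khomM hphi) ?(khom1 hphi) //.
have hid : is_kalg_hom (@id A) by split.
move=> /(_ hip hid); rewrite /= pe pf ph => /(_ erefl erefl erefl a) <-.
by have /asboolP := gen_valP (phi a).
Qed.
End Evaluation.

(** * The classical limit: independence of ordered words and the modules V(n) *)

Section CharZero.
Variable k : fieldType.
Hypothesis char0 : [pchar k] =i pred0.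

Lemma natr_eq0_char0 n : (n%:R == 0 :> k) = (n == 0)%N.
Proof. exact: (pcharf0P k).1. Qed.

Lemma natr_inj_char0 : injective (fun n => n%:R : k).
Proof.
move=> m n; wlog mn : m n / (m <= n)%N => [h e|].
  by case/orP: (leq_total m n) => /h; [exact | move=> h'; apply/esym/h'].
move=> /esym/eqP; rewrite -subr_eq0 -natrB // natr_eq0_char0; lia.
Qed.

Lemma poly_many_roots (q : {poly k}) (h : nat -> k) n0 : injective h ->
  (forall n, (n0 <= n)%N -> q.[h n] = 0) -> q = 0.
Proof.
move=> hinj hq; apply/eqP/negPn/negP => q0.
have := max_poly_roots q0 (rs := [seq h n | n <- iota n0 (size q)]).
rewrite size_map size_iota ltnn => H; suff: false by []; apply: H.
  by apply/allP => _ /mapP[n + ->]; rewrite mem_iota => /andP[+ _] => /hq/eqP.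
by rewrite map_inj_uniq // iota_uniq.
Qed.

Variable psi : nat -> int -> pser k.
Hypothesis hpsi : colouring psi.

Local Notation psi0 := (psi0 psi).
Local Notation Wc := (Wc psi).
Local Notation actL := (actL psi).

Lemma psi0_0 j n : psi0 j n 0 = (j%:Z * (n - j%:Z + 1))%:~R.
Proof. by case: j => [|j] /=; rewrite ?mul0r //; case: hpsi => -> . Qed.

(** At most one of the two truncated differences is nonzero, so for j <= n the value is a natural
    number. *)
Lemma psi0_n j (n : nat) : psi0 j n%:Z 0 = ((j * (n.+1 - j))%N)%:R - (j * (j - n.+1))%N%:R.
Proof.
rewrite psi0_0 !pmulrn -rmorphB /=; congr (_%:~R).
by rewrite !PoszM -mulrBr; congr (_ * _); lia.
Qed.

Lemma psi0_neq0 j (n : nat) : (0 < j <= n)%N -> psi0 j n%:Z 0 != 0.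
Proof.
move=> jn; rewrite psi0_n (_ : j - n.+1 = 0)%N ?muln0 ?subr0; last by lia.
by rewrite natr_eq0_char0 muln_eq0; lia.
Qed.

Lemma word_act_Xp_pow c n j :
  (word_act psi n (nseq c GXp) j).2 = (j - c)%N /\
  (word_act psi n (nseq c GXp) j).1 0%N = \prod_(l < c) psi0 (j - l)%N n 0.
Proof.
elim: c => [|c [IH2 IH1]]; first by rewrite big_ord0 subn0.
rewrite -[nseq _ _]/(GXp :: nseq c GXp) word_act_Xp2 word_act_Xp1 psmul0 IH1 IH2.
by split; [rewrite -subn1 -subnDA addn1 | rewrite big_ord_recr mulrC].
Qed.

Lemma word_act_H_pow b n w j :
  (word_act psi n (nseq b GH ++ w) j).2 = (word_act psi n w j).2 /\
  (word_act psi n (nseq b GH ++ w) j).1 0%N =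
    ((n - 2 * (word_act psi n w j).2%:Z)%:~R) ^+ b * (word_act psi n w j).1 0%N.
Proof.
elim: b => [|b [IH2 IH1]]; first by rewrite expr0 mul1r.
rewrite -[nseq _ _ ++ _]/(GH :: nseq b GH ++ w) word_act_H2 word_act_H IH1 IH2.
by rewrite exprS mulrA.
Qed.

Lemma word_act_Xm_pow a n w j :
  (word_act psi n (nseq a GXm ++ w) j).2 = (a + (word_act psi n w j).2)%N /\
  (word_act psi n (nseq a GXm ++ w) j).1 0%N = (word_act psi n w j).1 0%N.
Proof.
elim: a => [|a [IH2 IH1]] //.
by rewrite -[nseq _ _ ++ _]/(GXm :: nseq a GXm ++ w) word_act_Xm2 word_act_Xm1 IH1 IH2.
Qed.

(** For c > j the truncation in [j - c] is harmless: the product then contains the factor psi^0 =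
    0. *)
Lemma Wc_mono a b c n j i : Wc n (mono a b c) j i 0 =
  if (a + (j - c) == i)%N then
    (n - 2 * (j - c)%N%:Z)%:~R ^+ b * \prod_(l < c) psi0 (j - l)%N n 0
  else 0.
Proof.
rewrite /Wc /mono; have [-> ->] := word_act_Xm_pow a n (nseq b GH ++ nseq c GXp) j.
have [-> ->] := word_act_H_pow b n (nseq c GXp) j.
by have [-> ->] := word_act_Xp_pow c n j.
Qed.

(* Induction on the power c of X^+: applied to b_c, ordered words with a higher
   power of X^+ vanish, so the b_a-component isolates the words f^a h^b e^c. *)
Lemma NF_independent x : NF x ->
  (forall (n : nat) i j, (i <= n)%N -> (j <= n)%N -> actL n%:Z j i 0 x = 0) ->
  forall w, Fcoef x w = 0.
Proof.
move=> nx hx.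
suff H c : forall a b, Fcoef x (mono a b c) = 0.
  move=> w; have [ow|ow] := boolP (ordered w); last exact: NF_coef.
  by rewrite (orderedE ow).
elim/ltn_ind: c => c IH a.
pose isac w := w == mono a (count_mem GH w) c.
(* With a and c fixed, [q] collects the coefficients of f^a h^b e^c for all b. *)
pose q : {poly k} := lin (fun w => if isac w then 'X^(count_mem GH w) else 0) x.
have isacE a' b' c' : isac (mono a' b' c') = (a' == a) && (c' == c).
  rewrite /isac; apply/eqP/andP => [ew|[/eqP-> /eqP->]]; last first.
    by rewrite /mono !count_cat !count_nseq /= mul0n mul1n !addn0.
  have h g := congr1 (count_mem g) ew.
  have := h GXm; have := h GXp.
  by rewrite /mono !count_cat !count_nseq /= !mul0n !mul1n !addn0 !add0n => -> ->.
have qb b : q`_b = Fcoef x (mono a b c).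
  rewrite FcoefE /q (lin_map (L := fun p : {poly k} => p`_b : k^o)) => [|u v|c' v];
    rewrite ?coefD ?coefZ //.
  apply: (@eq_lin k k^o) => w /=; rewrite /isac; case: eqP => [ew|ew]; last first.
    rewrite coef0; case: eqP => // ewb; case: ew; rewrite ewb; apply/eqP.
    by rewrite -/(isac _) isacE !eqxx.
  rewrite coefXn; congr (_%:R); congr (nat_of_bool _).
  rewrite {2}ew; apply/eqP/eqP => [->//|em].
  have := congr1 (count_mem GH) em.
  by rewrite /mono !count_cat !count_nseq /= !mul0n !mul1n !addn0 !add0n.
suff q0 : q = 0 by move=> b; rewrite -qb q0 coef0.
apply: (poly_many_roots (h := fun n => n%:R) (n0 := (a + c)%N) natr_inj_char0) => n nac.
(* Modulo h, the c-th power of X^+ sends b_c to [gam] times b_0, where H has eigenvalue n; so the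
   b_a-component of x b_c is q(n) times [gam], and [gam] is nonzero because n >= c. *)
pose gam := \prod_(l < c) psi0 (c - l)%N n%:Z 0.
have gam0 : gam != 0.
  by apply/prodf_neq0 => l _; apply: psi0_neq0; have := ltn_ord l; lia.
apply: (mulIf gam0); rewrite mul0r.
have := hx n a c; rewrite !(leq_trans _ nac) ?leq_addl ?leq_addr // => /(_ isT isT) <-.
have -> : q.[n%:R] * gam =
    lin (fun w => (if isac w then n%:R ^+ count_mem GH w * gam else 0) : k^o) x.
  have -> : q.[n%:R] = lin (fun w => (if isac w then n%:R ^+ count_mem GH w else 0) : k^o) x.
    rewrite /q (lin_map (L := fun p : {poly k} => p.[n%:R] : k^o)) => [|u v|c' v];
      rewrite ?hornerD ?hornerZ //.
    by apply: (@eq_lin k k^o) => w /=; case: ifP; rewrite ?hornerXn ?horner0.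
  rewrite mulrC -linMl; apply: (@eq_lin k k^o) => w; case: ifP; rewrite ?mulr0 // mulrC //.
apply: (@eq_lin_coef k k^o) => w.
have [ow|ow] := boolP (ordered w); last by rewrite NF_coef ?scale0r.
rewrite (orderedE ow); set a' := count_mem _ _; set b' := count_mem _ _.
set c' := count_mem _ _.
have [lc|gc|ec] := ltngtP c' c.
- by rewrite IH ?scale0r.
- rewrite isacE (gtn_eqF gc) andbF Wc_mono (bigD1 (Ordinal gc)) //= subnn /= mul0r mulr0.
  by rewrite if_same.
- rewrite isacE Wc_mono ec eqxx andbT subnn addn0 mulr0 subr0 -/gam.
  have -> : count_mem GH (mono a' b' c) = b'.
    by rewrite /mono !count_cat !count_nseq /= !mul0n !mul1n !addn0 !add0n.
  by case: eqP.
Qed.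

(** The simple module V(n) on b_0, ..., b_n. Column j is the image of b_j, hence the exchanged
    indices. *)
Definition gm (n : nat) g : 'M[k]_n.+1 := \matrix_(i, j) Wc n%:Z [:: g] j i 0.
Definition wm (n : nat) (w : seq gen) : 'M[k]_n.+1 := \prod_(g <- w) gm n g.

Lemma wm_cons n g w : wm n (g :: w) = gm n g *m wm n w.
Proof. by rewrite /wm big_cons. Qed.

(* b_{n+1} cannot be brought back down since psi^{n+1}(n) = 0. *)
Lemma wmE n w i j : wm n w i j = Wc n%:Z w j i 0.
Proof.
elim: w i j => [|g w IH] i j.
  by rewrite /wm big_nil mxE /Wc /= eq_sym; case: eqP => [->|/eqP ne]; rewrite ?eqxx ?ifN.
rewrite wm_cons mxE /Wc word_act_cons2 word_act_cons1 psmul0.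
under eq_bigr => l _.
  rewrite IH mxE {1}/Wc word_act_cons2 word_act_cons1 psmul0 /= mulr1; over.
rewrite /= /Wc; set t := (word_act _ _ w j).2; set c := (word_act _ _ w j).1 _.
have [tn|tn] := ltnP t n.+1.
  rewrite (bigD1 (Ordinal tn)) //= eqxx big1 ?addr0; last first.
    move=> l lt; rewrite (_ : (t == l) = false) ?mulr0 //.
    by apply/negP => /eqP et; case/eqP: lt; apply: val_inj.
  by case: eqP => //; rewrite mul0r.
rewrite big1 => [|l _]; last first.
  rewrite (_ : (t == l) = false) ?mulr0 //; apply/negP => /eqP et.
  by have := ltn_ord l; rewrite -et ltnNge tn.
case: eqP => // ti; case: g ti => /=; try by have := ltn_ord i; lia.
case: t tn => [|t] tn /= ti //; have := ltn_ord i => iN.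
have -> : t.+1 = n.+1 by lia.
by case: hpsi => _ -> _; rewrite mul0r.
Qed.

Lemma gm_sl2 n : sl2_rel (gm n GXp) (gm n GXm) (gm n GH).
Proof.
have w2 g g' : gm n g * gm n g' = wm n [:: g; g'] by rewrite /wm !big_cons big_nil mulr1.
have w1 g : gm n g = wm n [:: g] by rewrite /wm big_seq1.
have s2 (M : 'M[k]_n.+1) : 2%:R * M = 2%:R *: M.
  by rewrite -[2%:R : 'M_ _]scaler_nat -scalerAl mul1r.
rewrite /sl2_rel !w2 !s2 !w1.
split; apply/matrixP => i j; rewrite !(mxE, wmE) /Wc;
  rewrite !(word_act_H, word_act_H2, word_act_Xp2, word_act_Xp1, word_act_Xm2, word_act_Xm1) /=;
  rewrite ?psmul0 ?word_act_H ?word_act_Xm1 /=.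
- case: eqP => _; last by rewrite subrr mulr0.
  case: (nat_of_ord j) => [|j'] /=; first by rewrite !(mul0r, mulr0) subrr.
  rewrite (_ : j'.+1%:Z = j'%:Z + 1); last by lia.
  rewrite !(rmorphB, rmorphM, rmorphD, rmorph1) /=; ring.
- case: eqP => _; last by rewrite subrr mulr0 oppr0.
  rewrite (_ : (nat_of_ord j).+1%:Z = (nat_of_ord j)%:Z + 1); last by lia.
  rewrite !(rmorphB, rmorphM, rmorphD, rmorph1) /=; ring.
(* At j = 0 the index [j.-1.+1] is 1 instead of j; the coefficient of this spurious entry is psi^0 =
   0. *)
- have -> : (nat_of_ord j).-1.+1 == i = (nat_of_ord j == i) && (0 < j)%N ||
      (j == 0%N :> nat) && (i == 1%N :> nat).
    by case: (nat_of_ord j) => [|j'] /=; rewrite ?andbT ?andbF ?orbF // eq_sym.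
  rewrite -[psi _ _ _]/(psi0 (nat_of_ord j).+1 n%:Z 0) !psi0_0 ?psmul0 /= ?mulr1 ?psi0_0.
  case: (nat_of_ord j) => [|j'] /=.
    by rewrite mul0r if_same subr0 mul1r subrK mulr0 subr0.
  rewrite andbT orbF; case: eqP => // _; last by rewrite subrr.
  rewrite (_ : j'.+2%:Z = j'%:Z + 2); last by lia.
  rewrite (_ : j'.+1%:Z = j'%:Z + 1); last by lia.
  by rewrite !(rmorphB, rmorphM, rmorphD, rmorph1) /=; ring.
Qed.
End CharZero.

(** * Highest weight vectors of finite-dimensional sl_2-modules *)

Section Sl2Triples.
Variable k : fieldType.
Hypothesis char0 : [pchar k] =i pred0.
Variable n : nat.
Implicit Types (E F H : 'M[k]_n.+1) (v : 'cV[k]_n.+1).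

(* The powers of E are eigenvectors of ad H for infinitely many eigenvalues. *)
Lemma ad_eigen_nilpotent (c : k) H E : c != 0 -> H * E - E * H = c *: E ->
  exists m, E ^+ m == 0.
Proof.
move=> c0 rel; have relX m : H * E ^+ m - E ^+ m * H = (m%:R * c) *: E ^+ m.
  elim: m => [|m IH]; first by rewrite expr0 mulr1 mul1r subrr mul0r scale0r.
  rewrite exprS mulrA -[_ * E](subrK (E * H)) rel mulrDl -scalerAl -!mulrA.
  rewrite -[H * E ^+ m](subrK (E ^+ m * H)) IH mulrDr -scalerAr.
  by rewrite mulrA addrA addrK -scalerDl -natr1 mulrDl mul1r addrC.
apply: contrapT => /forallNP nz0.
have nz m : E ^+ m != 0 by apply/negP; exact: nz0.
(* This is ad H; its characteristic polynomial would have every m c as a root. *)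
pose lL := (fun M : 'M[k]_n.+1 => H *m M - M *m H).
have lLlin : linear lL.
  move=> a u v; rewrite /lL mulmxDr mulmxDl -scalemxAr -scalemxAl scalerBr opprD.
  by rewrite addrACA.
pose LL := HB.pack_for {linear 'M[k]_n.+1 -> 'M[k]_n.+1} lL
  (GRing.isLinear.Build k _ _ _ lL lLlin).
have root m : root (char_poly (lin_mx LL)) (m%:R * c).
  rewrite -eigenvalue_root_char; apply/eigenvalueP; exists (mxvec (E ^+ m)).
    by rewrite mul_vec_lin /= -[lL _]/(H * E ^+ m - E ^+ m * H) relX linearZ.
  by rewrite mxvec_eq0.
have p0 : char_poly (lin_mx LL) = 0.
  apply: (poly_many_roots (h := fun m => m%:R * c) (n0 := 0)) => [|m _].
    by move=> m m' /(mulIf c0); exact: natr_inj_char0.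
  exact/eqP/root.
by have := char_poly_monic (lin_mx LL); rewrite p0 monicE lead_coef0 eq_sym oner_eq0.
Qed.

Lemma nilpotent_ker E v : (exists m, E ^+ m == 0) -> v != 0 ->
  exists m, E ^+ m *m v != 0 /\ E ^+ m.+1 *m v = 0.
Proof.
move=> [m0 /eqP Em0] v0.
have ex : exists m, E ^+ m *m v == 0 by exists m0; rewrite Em0 mul0mx.
case: (ex_minnP ex) => -[|m] /eqP mv hm.
  by move: v0; rewrite -mv expr0 mul1mx eqxx.
by exists m; split=> //; apply/negP => /hm; rewrite ltnn.
Qed.

Variables (E F H : 'M[k]_n.+1).
Hypothesis rel : sl2_rel E F H.

Lemma two_mx (M : 'M[k]_n.+1) : 2%:R * M = 2%:R *: M.
Proof. by rewrite -[2%:R : 'M_ _]scaler_nat -scalerAl mul1r. Qed.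

Lemma sl2_HE : H * E = E * H + 2%:R *: E.
Proof. by case: rel => h _ _; rewrite -two_mx -h addrC subrK. Qed.
Lemma sl2_HF : H * F = F * H - 2%:R *: F.
Proof. by case: rel => _ h _; rewrite -two_mx -h addrC subrK. Qed.
Lemma sl2_EF : E * F = F * E + H.
Proof. by case: rel => _ _ h; rewrite -h addrC subrK. Qed.

Lemma sl2_HFm m : H * F ^+ m = F ^+ m * H - (2%:R * m%:R) *: F ^+ m.
Proof.
elim: m => [|m IH]; first by rewrite mulr0 scale0r subr0 expr0 mulr1 mul1r.
rewrite exprS mulrA sl2_HF mulrBl -scalerAl -!mulrA IH mulrBr -scalerAr mulrA -addrA.
by rewrite -opprD -scalerDl -[m.+1%:R]natr1 mulrDr mulr1.
Qed.

(** On a vector v of weight i killed by E, this gives E F^(m+1) v = (m + 1) (i - m) F^m v, the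
    formula behind all weight computations below. *)
Lemma sl2_EFm m : E * F ^+ m.+1 = F ^+ m.+1 * E + m.+1%:R *: (F ^+ m * (H - m%:R%:A)).
Proof.
elim: m => [|m IH]; first by rewrite !expr1 expr0 mul1r scale1r scale0r subr0 sl2_EF.
rewrite [in LHS]exprS mulrA sl2_EF mulrDl -mulrA IH mulrDr mulrA -exprS -addrA; congr (_ + _).
rewrite sl2_HFm -scalerAr mulrA -exprS !mulrBr -!scalerAr !mulr1 !scalerBr !scalerA.
rewrite addrACA -{2}[F ^+ _ * H]scale1r -scalerDl natr1; congr (_ + _).
rewrite -opprD -scalerDl; congr (- (_ *: _)).
by rewrite -[m.+2%:R]natr1 -[m.+1%:R]natr1; ring.
Qed.

(** As k need not be algebraically closed, the weight is extracted from the nilpotency of F. If E w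
    = 0 and F^(M+1) w = 0, applying E gives F^M w' = 0 for w' = (H - M) w, which E kills too. Either
    w' = 0 and w has weight M, or the descent continues with w' and a smaller exponent. *)
Lemma sl2_highest_weight : exists (v : 'cV[k]_n.+1) (i : nat),
  [/\ v != 0, E *m v = 0 & H *m v = i%:R *: v].
Proof.
have n2 : 2%:R != 0 :> k by rewrite natr_eq0_char0.
have nE : exists m, E ^+ m == 0.
  by apply: (@ad_eigen_nilpotent 2%:R H) => //; rewrite sl2_HE addrC addKr.
have [M FM] : exists m, F ^+ m == 0.
  apply: (@ad_eigen_nilpotent (- 2%:R) H); first by rewrite oppr_eq0.
  by rewrite sl2_HF addrC addKr scaleNr.
have [w0 Ew0] : exists v : 'cV[k]_n.+1, v != 0 /\ E *m v = 0.
  have d0 : (delta_mx 0 0 : 'cV[k]_n.+1) != 0.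
    by apply/eqP => /matrixP/(_ 0 0); rewrite !mxE => /eqP; rewrite oner_eq0.
  have [m [mv mv']] := nilpotent_ker nE d0.
  by exists (E ^+ m *m delta_mx 0 0); rewrite mulmxA -[E *m _]exprS.
have : F ^+ M *m w0 = 0 by rewrite (eqP FM) mul0mx.
elim: M w0 Ew0 {FM} => [|M IH] w [w0 Ew] Fw.
  by move: w0; rewrite -Fw expr0 mul1mx eqxx.
pose w' := H *m w - M%:R *: w.
have Fw' : F ^+ M *m w' = 0.
  have /eqP := congr1 (mulmx E) Fw; rewrite mulmx0 mulmxA -[E *m _]/(E * _) sl2_EFm.
  rewrite mulmxDl -mulmxA Ew mulmx0 add0r -scalemxAl scaler_eq0 natr_eq0_char0 //=.
  by rewrite -mulmxA mulmxBl -scalemxAl mul1mx => /eqP.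
have Ew' : E *m w' = 0.
  rewrite /w' mulmxBr mulmxA -scalemxAr Ew scaler0 subr0.
  have -> : E *m H = H * E - 2%:R *: E by rewrite sl2_HE addrK.
  by rewrite mulmxBl -mulmxA -scalemxAl Ew scaler0 mulmx0 subr0.
have [w'0|w'0] := eqVneq w' 0; last exact: IH Fw'.
by exists w, M; split=> //; apply/eqP; rewrite -subr_eq0 -/w' w'0.
Qed.

(** If d is the last exponent with F^d v nonzero, applying E to F^(d+1) v = 0 gives (d + 1) (i - d)
    F^d v = 0, so the weight i is d. *)
Lemma sl2_string : exists (v : 'cV[k]_n.+1) (d : nat),
  [/\ v != 0, E *m v = 0, H *m v = d%:R *: v & F ^+ d.+1 *m v = 0].
Proof.
have [v [i [v0 Ev Hv]]] := sl2_highest_weight.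
have nF : exists m, F ^+ m == 0.
  apply: (@ad_eigen_nilpotent (- 2%:R) H); first by rewrite oppr_eq0 natr_eq0_char0.
  by rewrite sl2_HF addrC addKr scaleNr.
have [d [Fd Fd1]] := nilpotent_ker nF v0.
suff id : i = d by exists v, d; split; rewrite // Hv id.
apply: (natr_inj_char0 char0); apply/eqP; rewrite -subr_eq0.
have /eqP := congr1 (mulmx E) Fd1; rewrite mulmx0 mulmxA -[E *m _]/(E * _) sl2_EFm.
rewrite mulmxDl -mulmxA Ev mulmx0 add0r -scalemxAl scaler_eq0 natr_eq0_char0 //=.
rewrite -mulmxA mulmxBl Hv -scalemxAl mul1mx -scalerBl -scalemxAr scaler_eq0.
by rewrite (negPf Fd) orbF.
Qed.

End Sl2Triples.

(** * U(sl_2): ordered basis, faithfulness on the V(n), and [K0] against the kernel of [ev] *)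

Section Usl2.
Variable k : fieldType.
Hypothesis char0 : [pchar k] =i pred0.
Variable psi : nat -> int -> pser k.
Hypothesis hpsi : colouring psi.
Variables (A : algType k) (e f hh : A).
Hypothesis hA : is_Usl2 e f hh.

Local Notation gA := (gA e f hh).
Local Notation wA := (wA e f hh).
Local Notation ev := (ev e f hh).
Local Notation gm := (gm psi).
Local Notation wm := (wm psi).

Lemma rho_ex n : exists rho : A -> 'M[k]_n.+1,
  is_kalg_hom rho /\ forall g, rho (gA g) = gm n g.
Proof.
have [_ /(_ 'M[k]_n.+1 _ _ _ (gm_sl2 hpsi n))[[rho [hrho [re rf rh]]] _]] := hA.
by exists rho; split=> //; case.
Qed.

Definition rho n : A -> 'M[k]_n.+1 := projT1 (cid (rho_ex n)).
Lemma rho_hom n : is_kalg_hom (rho n).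
Proof. by rewrite /rho; case: cid => r []. Qed.
Lemma rho_gA n g : rho n (gA g) = gm n g.
Proof. by rewrite /rho; case: cid => r []. Qed.

Lemma rho_wA n w : rho n (wA w) = wm n w.
Proof. by rewrite /wA (khom_prod (rho_hom n)); apply: eq_bigr => g _; exact: rho_gA. Qed.

Lemma rho_ev n x i j : rho n (ev x) i j = actL psi n%:Z j i 0 x.
Proof.
rewrite /ev (khom_lin (rho_hom n)).
rewrite (lin_map (L := fun M : 'M[k]_n.+1 => M i j : k^o)) => [|u v|c u]; rewrite ?mxE //.
by apply: (@eq_lin k k^o) => w /=; rewrite rho_wA (wmE hpsi).
Qed.

Lemma ev_eq x y : Feq x y -> ev x = ev y.
Proof. exact: Feq_lin. Qed.

Lemma ev_lmul g x : ev (Flmul g x) = gA g * ev x.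
Proof.
rewrite /ev lin_lmul (lin_map (L := fun a => gA g * a)) => [|u v|c u];
  rewrite ?mulrDr ?scalerAr //.
by apply: eq_lin => w /=; exact: wA_cons.
Qed.

Lemma ev_straighten x : exists2 y, NF y & ev x = ev y.
Proof.
have [y ny exy] : exists2 y, NF y & ev (x ++ Fopp y) = 0.
  have [[r1 r2 r3] _] := hA.
  apply: (straighten (I := fun x => ev x = 0)).
  - by move=> u v /ev_eq ->.
  - by move=> u v; rewrite /ev lin_cat => -> ->; rewrite addr0.
  - by move=> c u; rewrite /ev lin_scale => ->; rewrite scaler0.
  - by move=> g u; rewrite ev_lmul => ->; rewrite mulr0.
  - move=> w; rewrite /ev /rel_Hp !lin_cons lin_nil !wA_cons /= addr0 scale1r.
    rewrite !scaleNr scale1r !mulrA scaler_nat -mulr_natl addrA -mulrBl r1.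
    by rewrite mulrA subrr.
  - move=> w; rewrite /ev /rel_Hm !lin_cons lin_nil !wA_cons /= addr0 scale1r.
    rewrite !scaleNr scale1r !mulrA scaler_nat -mulr_natl addrA -mulrBl r2.
    by rewrite mulNr !mulrA addNr.
  - move=> w; rewrite /ev /rel_pm !lin_cons lin_nil !wA_cons /= addr0 scale1r.
    by rewrite !scaleNr !scale1r !mulrA addrA -mulrBl r3 subrr.
exists y => //; apply/eqP; rewrite -subr_eq0; apply/eqP.
by move: exy; rewrite /ev lin_cat lin_opp.
Qed.

Lemma NF_ev0 x : NF x -> ev x = 0 -> forall w, Fcoef x w = 0.
Proof.
move=> nx ex; apply: (NF_independent char0 hpsi nx) => n i j iN jN.
have := rho_ev x (Ordinal (iN : (i < n.+1)%N)) (Ordinal (jN : (j < n.+1)%N)).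
by rewrite ex (khom0 (rho_hom n)) mxE.
Qed.

(** An ordered representative of [a] has zero matrix coefficients on every V(n), so [NF_independent]
    kills its word coefficients. *)
Lemma rho_faithful a : (forall n, rho n a = 0) -> a = 0.
Proof.
move=> ha; have [x ex] := ev_surj hA a; have [y ny exy] := ev_straighten x.
rewrite -ex exy; apply: lin_eq0 => w.
rewrite (NF_independent char0 hpsi ny) ?scale0r // => n i j iN jN.
have := rho_ev y (Ordinal (iN : (i < n.+1)%N)) (Ordinal (jN : (j < n.+1)%N)).
by rewrite -exy ex ha mxE.
Qed.

(** At order 0 only the constant term of y acts, so it acts by zero on every V(n). *)
Lemma annih_ev y : annih psi y -> ev (y 0%N) = 0.
Proof.
move=> ay; apply: rho_faithful => n; apply/matrixP => i j; rewrite rho_ev mxE.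
by have := ay n%:Z j 0%N i; rewrite act_basisE big_ord1 subn0.
Qed.

Lemma K0_ev x : K0 psi x -> ev x = 0.
Proof. by move=> [y /annih_ev ey /ev_eq <-]. Qed.

(** Modulo [K0], x is congruent to an ordered y. Since [ev] vanishes on [K0], y evaluates to zero as
    well, and ordered words are independent. *)
Lemma ev_K0 : (forall w, K0 psi (rel_pm k w)) -> forall x, ev x = 0 -> K0 psi x.
Proof.
move=> hpm x ex; have [y ny ky] : exists2 y, NF y & K0 psi (x ++ Fopp y).
  apply: straighten => //.
  - exact: K0_eq.
  - exact: K0_cat.
  - exact: K0_scale.
  - exact: K0_lmul.
  - exact: K0_Hp.
  - exact: K0_Hm.
have ey : ev y = 0.
  by move: (K0_ev ky); rewrite /ev lin_cat lin_opp -/(ev x) ex add0r => /eqP;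
    rewrite oppr_eq0 => /eqP.
by apply: K0_eq ky => w; rewrite !FcoefD (NF_ev0 ny ey) subr0.
Qed.

(** For 1 <= l <= d, X^+ b_l is a nonzero multiple of b_(l-1), so a vector killed by X^+ has no
    component beyond b_0. *)
Lemma gm_Xp_ker d (c : 'cV[k]_d.+1) : gm d GXp *m c = 0 -> c = c 0 0 *: delta_mx 0 0.
Proof.
move=> hc; apply/colP => l; rewrite !mxE eqxx andbT.
have [->|l0] := eqVneq l 0; first by rewrite mulr1.
rewrite mulr0; have lp : (0 < l)%N by rewrite lt0n.
have ld : (l.-1 < d.+1)%N by have := ltn_ord l; lia.
have /eqP := congr1 (fun M : 'cV[k]_d.+1 => M (Ordinal ld) 0) hc.
have h i : Wc psi d%:Z [:: GXp] i l.-1 0 = if i.-1 == l.-1 then psi0 psi i d%:Z 0 else 0.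
  by rewrite /Wc word_act_Xp2 word_act_Xp1 psmul0 /= mulr1.
rewrite !mxE (bigD1 l) //= mxE h eqxx big1 ?addr0 => [|i il]; last first.
  rewrite mxE h; case: eqP => [il1|]; last by rewrite mul0r.
  case: (posnP i) => [->|ip]; first by rewrite mul0r.
  by case/eqP: il; apply: val_inj => /=; lia.
rewrite mulf_eq0 (negPf (psi0_neq0 char0 hpsi _)) /= => [/eqP//|].
by have := ltn_ord l; lia.
Qed.

Lemma gm_to_top d (c : 'cV[k]_d.+1) : c != 0 ->
  exists s a, a != 0 /\ gm d GXp ^+ s *m c = a *: delta_mx 0 0.
Proof.
move=> c0; have [r1 _ _] := gm_sl2 hpsi d.
have nE : exists m, gm d GXp ^+ m == 0.
  apply: (ad_eigen_nilpotent char0 (c := 2%:R) (H := gm d GH)).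
    by rewrite natr_eq0_char0.
  by rewrite r1 two_mx.
have [s [s0 s1]] := nilpotent_ker nE c0.
have ker : gm d GXp *m (gm d GXp ^+ s *m c) = 0.
  by rewrite mulmxA -[gm d GXp *m _]exprS.
move: s0; rewrite (gm_Xp_ker ker); set a := fun_of_matrix _ _ _ => s0.
exists s, a; split; last by rewrite (gm_Xp_ker ker).
by apply: contraNneq s0 => ->; rewrite scale0r.
Qed.

Lemma gm_Xm_pow d (i : 'I_d.+1) : gm d GXm ^+ i *m delta_mx 0 0 = delta_mx i 0 :> 'cV[k]_d.+1.
Proof.
have -> : gm d GXm ^+ i = wm d (nseq i GXm) by rewrite /wm big_nseq iter_mulr_1.
apply/colP => l; rewrite !mxE (bigD1 0) //= big1 ?addr0 => [|j j0]; last first.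
  by rewrite !mxE (negPf j0) mulr0.
rewrite wmE // mxE eqxx mulr1 -[nseq i GXm]cats0 /Wc.
have [-> ->] := word_act_Xm_pow psi i d%:Z [::] 0.
by rewrite /= addn0 andbT -val_eqE /= [nat_of_ord i == _]eq_sym; case: eqP.
Qed.

(** * Surjective endomorphisms of U(sl_2) are injective *)

Section Hopf.
Variable pi : A -> A.
Hypothesis hpi : is_kalg_hom pi.
Hypothesis pi_surj : forall a, exists b, pi b = a.
Variable n : nat.
Let s a := rho n (pi a).

Let hs : is_kalg_hom s.
Proof.
by split=> *; rewrite /s ?(khomD hpi, khomZ hpi, khomM hpi, khom1 hpi)
  ?(khomD (rho_hom n), khomZ (rho_hom n), khomM (rho_hom n), khom1 (rho_hom n)).
Qed.

Let srel : sl2_rel (s e) (s f) (s hh).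
Proof.
have [[r1 r2 r3] _] := hA.
by split; rewrite -?(khom_nat hs) -!(khomM hs) -?(khomN hs) -(khomD hs) ?r1 ?r2 ?r3.
Qed.

(** [T] maps V(d) to the pull-back [s] of V(n), sending b_j to F^j v. It is injective: X^+ raises a
    nonzero kernel vector to a nonzero multiple of b_0, which [T] sends to a nonzero multiple of v.
    It is surjective: as [pi] is onto, [s] takes all values of [rho n], and these carry v to every
    basis vector. So d = n, and [s a = 0] forces [rho n a = 0]. *)
Lemma pullback_kernel a : pi a = 0 -> rho n a = 0.
Proof.
move=> pa.
have [v [d [v0 Ev Hv Fv]]] := sl2_string char0 srel.
pose T : 'M[k]_(n.+1, d.+1) := \matrix_(i, j) (s f ^+ j *m v) i 0.
have Tgm g i (j : 'I_d.+1) : (T *m gm d g) i j =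
    (gen_act psi d%:Z g j).1 0%N * (s f ^+ (gen_act psi d%:Z g j).2 *m v) i 0.
  have gmE l : gm d g l j = Wc psi d%:Z [:: g] j l 0 by rewrite mxE.
  have W l : Wc psi d%:Z [:: g] j l 0 =
      if (gen_act psi d%:Z g j).2 == l then (gen_act psi d%:Z g j).1 0%N else 0.
    by rewrite /Wc word_act_cons2 word_act_cons1 psmul0 /= mulr1.
  (* The index leaves the range only as d + 1, where F^(d+1) v = 0 keeps the formula true. *)
  have : ((gen_act psi d%:Z g j).2 <= d.+1)%N.
    by have := ltn_ord j; case: g {W gmE} => //=; case: (nat_of_ord j) => //= j'; lia.
  move: W; case: gen_act => c t /= W; rewrite leq_eqVlt => /orP[/eqP td|td].
    rewrite td Fv !mxE mulr0 big1 // => l _; rewrite gmE W td.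
    by rewrite gtn_eqF ?mulr0.
  rewrite mxE (bigD1 (Ordinal td)) //= [T _ _]mxE gmE W eqxx mulrC.
  rewrite [X in _ + X]big1 ?addr0 // => l lt; rewrite gmE W (_ : (t == l) = false) ?mulr0 //.
  by apply/negP => /eqP et; case/eqP: lt; apply: val_inj.
have sT g i (j : 'I_d.+1) : (s (gA g) *m T) i j = (s (gA g) *m (s f ^+ j *m v)) i 0.
  by rewrite !mxE; apply: eq_bigr => l _; rewrite mxE.
have HF m : s hh *m (s f ^+ m *m v) = (d%:R - 2%:R * m%:R) *: (s f ^+ m *m v).
  rewrite mulmxA -[s hh *m _]/(s hh * _) (sl2_HFm srel) mulmxBl -mulmxA Hv.
  by rewrite -scalemxAr -scalemxAl -scalerBl.
have intg g : T *m gm d g = s (gA g) *m T.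
  apply/matrixP => i j; rewrite Tgm sT; case: g.
  - by rewrite /= HF [in RHS]mxE rmorphB rmorphM.
  - by rewrite /= mul1r exprS -mulmxA.
  - case: (nat_of_ord j) => [|j'].
      by rewrite /= mul0r mul1mx Ev mxE.
    rewrite gen_act_Xp1 gen_act_Xp2 (psi0_0 hpsi) mulmxA -[s e *m _]/(s e * _).
    rewrite (sl2_EFm srel) mulmxDl -mulmxA Ev mulmx0 add0r -scalemxAl.
    rewrite -mulmxA mulmxBl Hv -scalemxAl mul1mx -scalerBl -scalemxAr scalerA.
    rewrite [in RHS]mxE /=; congr (_ * _).
    rewrite (_ : j'.+1%:Z = j'%:Z + 1); last by lia.
    rewrite (_ : _ * _ = (j'%:Z + 1) * (d%:Z - j'%:Z)); last by lia.
    by rewrite rmorphM rmorphB rmorphD /= natr1.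
have int b : T *m rho d b = s b *m T.
  have [x <-] := ev_surj hA b.
  rewrite /ev (khom_lin (rho_hom d)) (khom_lin hs).
  rewrite (lin_map (L := fun M => T *m M)) => [|M N|c M]; rewrite ?mulmxDr ?scalemxAr //.
  rewrite (lin_map (L := fun M => M *m T)) => [|M N|c M]; rewrite ?mulmxDl ?scalemxAl //.
  apply: eq_lin => w /=; elim: w => [|g w IH].
    by rewrite /wA big_nil (khom1 hs) (khom1 (rho_hom d)) mul1mx mulmx1.
  rewrite wA_cons (khomM hs) (khomM (rho_hom d)) rho_gA -[gm d g * _]/(_ *m _).
  by rewrite mulmxA intg -mulmxA IH mulmxA.
have T0 : T *m delta_mx 0 0 = v.
  by apply/colP => i; rewrite -colE 2!mxE expr0 mul1mx.
have Tinj (c : 'cV[k]_d.+1) : T *m c = 0 -> c = 0.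
  move=> Tc; apply/eqP/negPn/negP => /gm_to_top[m [a' [a0]]].
  rewrite -(rho_gA d GXp) -(khomX (rho_hom d)) => h.
  have := congr1 (mulmx T) h; rewrite mulmxA int -mulmxA Tc mulmx0 -scalemxAr T0.
  by move/esym/eqP; rewrite scaler_eq0 (negPf a0) (negPf v0).
have Tsurj (i : 'I_n.+1) : exists c : 'cV[k]_d.+1, T *m c = delta_mx i 0.
  have [m [a' [a0 h]]] := gm_to_top v0.
  (* In V(n), the m-th power of X^+ takes v to a' b_0, and the i-th power of X^- takes b_0 to b_i; a
     preimage under [pi] realises this path through [s]. *)
  have [b bE] := pi_surj (a'^-1 *: (gA GXm ^+ i * gA GXp ^+ m)).
  exists (rho d b *m delta_mx 0 0); rewrite mulmxA int -mulmxA T0 /s bE.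
  rewrite (khomZ (rho_hom n)) (khomM (rho_hom n)) !(khomX (rho_hom n)) !rho_gA.
  rewrite -scalemxAl -[_ * _]/(_ *m _) -mulmxA h -scalemxAr scalerA mulVf // scale1r.
  exact: gm_Xm_pow.
have [S TS] : exists S : 'M_(d.+1, n.+1), T *m S = 1%:M.
  have [c hc] := choice Tsurj; exists (\matrix_(i, j) c j i 0).
  apply/matrixP => i j; have := congr1 (fun M : 'cV[k]_n.+1 => M i 0) (hc j).
  rewrite [RHS]mxE eqxx andbT => h; rewrite [RHS]mxE -h.
  by rewrite [LHS]mxE [RHS]mxE; apply: eq_bigr => l _; congr (_ * _); rewrite mxE.
have rT : \rank T = n.+1 by apply/eqP/row_freeP; exists S.
have rT' : \rank T^T = d.+1.
  apply/eqP/inj_row_free => u uT; apply: trmx_inj; rewrite trmx0; apply: Tinj.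
  by apply: trmx_inj; rewrite trmx_mul trmxK trmx0.
have dn : d = n by move: rT'; rewrite mxrank_tr rT => -[].
have Ta : T *m rho d a = 0 by rewrite int /s pa (khom0 (rho_hom n)) mul0mx.
move: Ta Tinj; clear -dn; move: T; rewrite -dn => T Ta Tinj.
apply/matrixP => i j; have : col j (rho d a) = 0.
  by apply: Tinj; rewrite colE mulmxA Ta mul0mx.
by move=> /colP/(_ i); rewrite !mxE.
Qed.
End Hopf.

Lemma hopfian (pi : A -> A) : is_kalg_hom pi -> (forall a, exists b, pi b = a) ->
  forall a, pi a = 0 -> a = 0.
Proof. by move=> hpi spi a pa; apply: rho_faithful => n; exact: pullback_kernel pa. Qed.

End Usl2.

(** * Polynomial functions, power sums, and the symmetry imposed by (C2) and (C3) *)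

Section PolynomialFunctions.
Variable k : fieldType.
Implicit Type g : k -> k -> k.

(** Working with functions turns substitutions such as y -> -y into plain composition. *)
Definition polyfun g := exists P : {poly {poly k}}, forall x y, g x y = peval2 P x y.

Lemma polyfun_ext g g' : (forall x y, g x y = g' x y) -> polyfun g -> polyfun g'.
Proof. by move=> e [P hP]; exists P => x y; rewrite -e. Qed.
Lemma polyfun_const c : polyfun (fun _ _ => c).
Proof. by exists c%:P%:P => x y; rewrite /peval2 !hornerC. Qed.
Lemma polyfun_fst : polyfun (fun x _ => x).
Proof. by exists ('X%:P) => x y; rewrite /peval2 hornerC hornerX. Qed.
Lemma polyfun_snd : polyfun (fun _ y => y).
Proof. by exists 'X => x y; rewrite /peval2 hornerX hornerC. Qed.
Lemma polyfunD g g' : polyfun g -> polyfun g' -> polyfun (fun x y => g x y + g' x y).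
Proof.
by move=> [P hP] [P' hP']; exists (P + P') => x y; rewrite hP hP' /peval2 !hornerD.
Qed.
Lemma polyfunM g g' : polyfun g -> polyfun g' -> polyfun (fun x y => g x y * g' x y).
Proof.
by move=> [P hP] [P' hP']; exists (P * P') => x y; rewrite hP hP' /peval2 !hornerM.
Qed.
Lemma polyfunN g : polyfun g -> polyfun (fun x y => - g x y).
Proof.
by move=> /(polyfunM (polyfun_const (-1))); apply: polyfun_ext => x y; rewrite mulN1r.
Qed.
Lemma polyfunB g g' : polyfun g -> polyfun g' -> polyfun (fun x y => g x y - g' x y).
Proof. by move=> hg /polyfunN; exact: polyfunD. Qed.
Lemma polyfunX g i : polyfun g -> polyfun (fun x y => g x y ^+ i).
Proof.
move=> hg; elim: i => [|i IH]; first exact: polyfun_const.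
by apply: polyfun_ext (polyfunM hg IH) => x y; rewrite exprS.
Qed.
Lemma polyfun_sum (I : Type) (r : seq I) (G : I -> k -> k -> k) :
  (forall i, polyfun (G i)) -> polyfun (fun x y => \sum_(i <- r) G i x y).
Proof.
move=> hG; elim: r => [|i r IH].
  by apply: polyfun_ext (polyfun_const 0) => x y; rewrite big_nil.
by apply: polyfun_ext (polyfunD (hG i) IH) => x y; rewrite big_cons.
Qed.

Lemma peval2E (P : {poly {poly k}}) x y :
  peval2 P x y = \sum_(i < size P) \sum_(l < size P`_i) P`_i`_l * x ^+ l * y ^+ i.
Proof.
rewrite /peval2 [P.[_]]horner_coef horner_sum; apply: eq_bigr => i _.
by rewrite hornerM -polyC_exp hornerC horner_coef mulr_suml.
Qed.

Lemma polyfun_comp g u v : polyfun g -> polyfun u -> polyfun v ->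
  polyfun (fun x y => g (u x y) (v x y)).
Proof.
move=> [P hP] hu hv.
apply: (@polyfun_ext (fun x y => \sum_(i < size P) \sum_(l < size P`_i)
  P`_i`_l * u x y ^+ l * v x y ^+ i)) => [x y|]; first by rewrite hP peval2E.
apply: polyfun_sum => i; apply: polyfun_sum => l; apply: polyfunM; last exact: polyfunX.
by apply: polyfunM; [exact: polyfun_const | exact: polyfunX].
Qed.

(* Functions of (j, n) that are polynomial in the eigenvalues n - 2j of H and
   j(n - j + 1) of X^- X^+ on the classical Verma modules. *)
Inductive wfun : (nat -> int -> k) -> Prop :=
| wfun_const c : wfun (fun _ _ => c)
| wfunD (g g' : nat -> int -> k) : wfun g -> wfun g' -> wfun (fun j n => g j n + g' j n)
| wfun_H (g : nat -> int -> k) : wfun g -> wfun (fun j n => (n - 2 * j%:Z)%:~R * g j n)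
| wfun_C (g : nat -> int -> k) : wfun g -> wfun (fun j n => (j%:Z * (n - j%:Z + 1))%:~R * g j n)
| wfun_ext (g g' : nat -> int -> k) : (forall j n, g j n = g' j n) -> wfun g -> wfun g'.

Lemma wfunM (g g' : nat -> int -> k) : wfun g -> wfun g' -> wfun (fun j n => g j n * g' j n).
Proof.
move=> hg hg'; elim: hg => {g}.
- move=> c; elim: hg' => {g'} [c'|g1 g2 _ h1 _ h2|g1 _ h1|g1 _ h1|g1 g2 e _ h1].
  + exact: wfun_const.
  + by apply: wfun_ext (wfunD h1 h2) => j n; rewrite mulrDr.
  + by apply: wfun_ext (wfun_H h1) => j n; rewrite mulrCA.
  + by apply: wfun_ext (wfun_C h1) => j n; rewrite mulrCA.
  + by apply: wfun_ext h1 => j n; rewrite e.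
- by move=> g1 g2 _ h1 _ h2; apply: wfun_ext (wfunD h1 h2) => j n; rewrite mulrDl.
- by move=> g1 _ h1; apply: wfun_ext (wfun_H h1) => j n; rewrite mulrA.
- by move=> g1 _ h1; apply: wfun_ext (wfun_C h1) => j n; rewrite mulrA.
- by move=> g1 g2 e _ h1; apply: wfun_ext h1 => j n; rewrite e.
Qed.

Lemma wfunB (g g' : nat -> int -> k) : wfun g -> wfun g' -> wfun (fun j n => g j n - g' j n).
Proof.
move=> hg hg'; apply: wfun_ext (wfunD hg (wfunM (wfun_const (-1)) hg')) => j n.
by rewrite mulN1r.
Qed.

Lemma wfun_sum (I : Type) (r : seq I) (G : I -> nat -> int -> k) :
  (forall i, wfun (G i)) -> wfun (fun j n => \sum_(i <- r) G i j n).
Proof.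
move=> hG; elim: r => [|i r IH].
  by apply: wfun_ext (wfun_const 0) => j n; rewrite big_nil.
by apply: wfun_ext (wfunD (hG i) IH) => j n; rewrite big_cons.
Qed.

Lemma wfunX (g : nat -> int -> k) i : wfun g -> wfun (fun j n => g j n ^+ i).
Proof.
move=> hg; elim: i => [|i IH]; first exact: wfun_const.
by apply: wfun_ext (wfunM hg IH) => j n; rewrite exprS.
Qed.

(** Under j -> j + 1 the eigenvalue of H drops by 2, and that of X^- X^+ grows by n - 2j, the
    eigenvalue of H. *)
Lemma wfun_shift (g : nat -> int -> k) : wfun g -> wfun (fun j n => g j.+1 n).
Proof.
have hH : wfun (fun j n => (n - 2 * j%:Z)%:~R).
  by apply: wfun_ext (wfun_H (wfun_const 1)) => j n; rewrite mulr1.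
have hC : wfun (fun j n => (j%:Z * (n - j%:Z + 1))%:~R).
  by apply: wfun_ext (wfun_C (wfun_const 1)) => j n; rewrite mulr1.
elim=> {g} [c|g1 g2 _ h1 _ h2|g1 _ h1|g1 _ h1|g1 g2 e _ h1].
- exact: wfun_const.
- exact: wfunD.
- apply: wfun_ext (wfunM (wfunB hH (wfun_const 2%:R)) h1) => j n.
  rewrite (_ : n - 2 * j.+1%:Z = n - 2 * j%:Z - 2); last by lia.
  by rewrite [in RHS]rmorphB.
- apply: wfun_ext (wfunM (wfunD hC hH) h1) => j n.
  rewrite -rmorphD /=; congr (_%:~R * _).
  rewrite (_ : j.+1%:Z = j%:Z + 1); last by lia. by ring.
- by apply: wfun_ext h1 => j n; rewrite e.
Qed.

Hypothesis char0 : [pchar k] =i pred0.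

Lemma polyfun_roots g y (h : nat -> k) : polyfun g -> injective h ->
  (forall n, (1 <= n)%N -> g (h n) y = 0) -> forall x, g x y = 0.
Proof.
move=> [P hP] hi h0 x; rewrite hP /peval2.
suff -> : P.[y%:P] = 0 by rewrite horner0.
by apply: (poly_many_roots hi) => n /h0; rewrite hP.
Qed.

(** Expand the telescoping sum of (i+1)^(j+1) - i^(j+1), equal to c^(j+1), by the binomial theorem
    and solve for the power sum of exponent j; its factor j + 1 is invertible in characteristic
    zero. *)
Lemma faulhaber j : exists S : {poly k},
  forall c : nat, \sum_(i < c) i%:R ^+ j = S.[c%:R].
Proof.
elim/ltn_ind: j => j IH.
have /choice[S hS] : forall l : 'I_j, exists S : {poly k},
    forall c : nat, \sum_(i < c) i%:R ^+ l = S.[c%:R].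
  by move=> l; apply: IH.
exists (j.+1%:R^-1 *: ('X^(j.+1) - \sum_(l < j) 'C(j.+1, l)%:R *: S l)) => c.
rewrite hornerZ hornerD hornerN hornerXn horner_sum.
have -> : c%:R ^+ j.+1 = \sum_(i < c) \sum_(l < j.+1) 'C(j.+1, l)%:R * i%:R ^+ l :> k.
  elim: c => [|c IHc]; first by rewrite expr0n big_ord0.
  rewrite big_ord_recr /= -IHc -natr1 [c%:R + 1]addrC exprDn big_ord_recr /= binn subnn expr0 mul1r mulr1n.
  rewrite [LHS]addrC; congr (_ + _); apply: eq_bigr => l _. 
  by rewrite expr1n mul1r mulr_natl.
have -> : \sum_(i < c) \sum_(l < j.+1) 'C(j.+1, l)%:R * i%:R ^+ l =
    \sum_(l < j) ('C(j.+1, l)%:R *: S l).[c%:R] + j.+1%:R * \sum_(i < c) i%:R ^+ j.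
  rewrite exchange_big big_ord_recr /= binSn mulr_sumr; congr (_ + _).
  by apply: eq_bigr => l _; rewrite hornerZ -hS mulr_sumr.
by rewrite addrC addKr mulKf // natr_eq0_char0.
Qed.

Lemma polyfun_partial_sum g : polyfun g -> exists2 g', polyfun g' &
  forall (c : nat) y, \sum_(i < c) g i%:R y = g' c%:R y.
Proof.
move=> [P hP]; have [S hS] := choice faulhaber.
exists (fun x y => \sum_(i < size P) \sum_(l < size P`_i)
  P`_i`_l * (S l).[x] * y ^+ i).
  apply: polyfun_sum => i; apply: polyfun_sum => l; apply: polyfunM; last first.
    by apply: polyfunX; exact: polyfun_snd.
  by apply: polyfunM; [exact: polyfun_const|exists (S l)%:P => x y; rewrite /peval2 hornerC].
move=> c y; under eq_bigr do rewrite hP peval2E.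
rewrite exchange_big; apply: eq_bigr => i _; rewrite exchange_big; apply: eq_bigr => l _.
by rewrite -mulr_suml -mulr_sumr hS.
Qed.

Variable psi : nat -> int -> pser k.
Hypothesis hpsi : colouring psi.
Local Notation psi0 := (psi0 psi).

Definition regular_at m := exists P : {poly {poly k}},
  forall (c : nat) (n : int), (1 <= c)%N -> psi c n m = peval2 P c%:R n%:~R.

Let half2 : (2%:R : k) != 0. Proof. by rewrite natr_eq0_char0. Qed.

(* In the coordinates x = n - 2c and y = n + 1, condition (C3) says that the
   polynomial is even in y, and (C2) then forces it to vanish at c = 0. *)
Lemma regular_even m : regular_at m -> exists2 Q, polyfun Q &
  forall (c : nat) (n : int), psi0 c n m = Q (n - 2 * c%:Z)%:~R (n + 1)%:~R /\
     psi0 c n m = Q (n - 2 * c%:Z)%:~R (- (n + 1)%:~R).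
Proof.
(* The inverse change of coordinates is c = (y - 1 - x) / 2, n = y - 1. *)
move=> [P hP]; pose Q x y := peval2 P ((y - 1 - x) / 2%:R) (y - 1).
have [c1 c2 c3] := hpsi.
have pQ : polyfun Q.
  apply: (@polyfun_comp (fun x y => peval2 P x y)); first by exists P.
    apply: polyfunM (polyfun_const _); apply: polyfunB polyfun_fst.
    exact: polyfunB polyfun_snd (polyfun_const _).
  exact: polyfunB polyfun_snd (polyfun_const _).
have QE (c : nat) (n : int) : Q (n - 2 * c%:Z)%:~R (n + 1)%:~R = peval2 P c%:R n%:~R.
  rewrite /Q !(rmorphB, rmorphM, rmorphD, rmorph1) /= addrK; congr (peval2 _ _ _).
  by field.
have QE' (c : nat) (n : int) : Q (n - 2 * c%:Z)%:~R (- (n + 1)%:~R) =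
    peval2 P (c%:R - n%:~R - 1) (- n%:~R - 2%:R).
  rewrite /Q !(rmorphB, rmorphM, rmorphD, rmorph1) /=; congr (peval2 _ _ _); last by ring.
  by field.
(* The index pairs (n + c + 1, n) and (c, -n - 2) of (C3) have the same x and opposite y; with n
   fixed, the c >= 1 give infinitely many x. *)
have even_pos (n : nat) : forall x, Q x n.+1%:R = Q x (- n.+1%:R).
  move=> x; apply/eqP; rewrite -subr_eq0; apply/eqP.
  have pR : polyfun (fun x y => Q x y - Q x (- y)).
    apply: polyfunB => //; apply: (@polyfun_comp Q) => //; first exact: polyfun_fst.
    by apply: polyfunN; exact: polyfun_snd.
  apply: (polyfun_roots (h := fun c => ((n%:Z - 2 * (n + c + 1)%N%:Z)%:~R)) pR).
    move=> c c' /eqP; rewrite -subr_eq0 -rmorphB /= => h.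
    have {h} : (2 * (c'%:Z - c%:Z))%:~R == 0 :> k.
      by apply: etrans h; congr (_%:~R == _); lia.
    rewrite rmorphM mulf_eq0 (negPf half2) rmorphB subr_eq0 /= => /eqP/(natr_inj_char0 char0).
    by move=> ->.
  move=> c c0; have -> : n.+1%:R = (n%:Z + 1)%:~R :> k by rewrite rmorphD /= natr1.
  rewrite QE QE' -hP ?addn1 // -addn1 c3 // hP //; apply/eqP; rewrite subr_eq0; apply/eqP.
  congr (peval2 _ _ _); last by rewrite rmorphB rmorphN.
  by rewrite !natrD; rewrite -[n%:Z%:~R]/(n%:R); ring.
have even (n : int) x : Q x n%:~R = Q x (- n%:~R).
  case: n => [[|n]|n]; first by rewrite oppr0.
    exact: even_pos.
  by rewrite NegzE rmorphN opprK; apply/esym/even_pos.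
(* In (C2), x = -n - 2 and y = n + 1; evenness replaces y by -n - 1 = x + 1. The line y = x + 1 is
   exactly c = 0. *)
have zero (y : k) : Q y (y + 1) = 0.
  pose g (x _ : k) := Q x (x + 1).
  apply: (@polyfun_roots g 0 (fun n => - (n.+1)%:R)).
  - apply: (@polyfun_comp Q) => //; first exact: polyfun_fst.
    by apply: polyfunD; [exact: polyfun_fst | exact: polyfun_const].
  - by move=> a b /oppr_inj/(natr_inj_char0 char0)[].
  - case=> // n _; rewrite /g.
    have := c2 n m; rewrite hP // -QE even; apply: etrans; congr Q.
      rewrite (_ : _ - _ = - (n.+2)%:Z) ?rmorphN //; lia.
    rewrite -[n.+2%:R]natr1 opprD addrNK; congr (- _).
    by rewrite rmorphD /= natr1.
exists Q => // c n; rewrite -even; suff -> : psi0 c n m = Q (n - 2 * c%:Z)%:~R (n + 1)%:~R by [].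
case: c => [|c]; last by rewrite QE -hP.
by rewrite mulr0 subr0 rmorphD /= zero.
Qed.

Lemma regular_psi0 m : regular_at m -> exists2 g, polyfun g &
  forall (c : nat) (n : int), psi0 c n m = g c%:R n%:~R.
Proof.
move=> /regular_even[Q hQ QE]; exists (fun x y => Q (y - 2%:R * x) (y + 1)).
  apply: (@polyfun_comp Q) => //.
    apply: polyfunB polyfun_snd _; exact: polyfunM (polyfun_const _) polyfun_fst.
  by apply: polyfunD; [exact: polyfun_snd | exact: polyfun_const].
by move=> c n; have [-> _] := QE c n; rewrite !(rmorphB, rmorphM, rmorphD, rmorph1).
Qed.

(** Averaging over y = n + 1 and -y leaves only even powers of y, and (n + 1)^2 = (n - 2j + 1)^2 + 4
    j (n - j + 1), essentially the Casimir eigenvalue. *)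
Lemma regular_wfun m : regular_at m -> wfun (fun j n => psi0 j n m).
Proof.
move=> /regular_even[Q [P hP] QE].
have hH : wfun (fun j n => (n - 2 * j%:Z)%:~R).
  by apply: wfun_ext (wfun_H (wfun_const 1)) => j n; rewrite mulr1.
have hN2 : wfun (fun j n => (n + 1)%:~R ^+ 2).
  have hC : wfun (fun j n => (j%:Z * (n - j%:Z + 1))%:~R).
    by apply: wfun_ext (wfun_C (wfun_const 1)) => j n; rewrite mulr1.
  apply: wfun_ext (wfunD (wfunX 2 (wfunD hH (wfun_const 1))) (wfunM (wfun_const 4%:R) hC)) => j n.
  by rewrite !(rmorphB, rmorphM, rmorphD, rmorph1) /=; ring.
have hN i : wfun (fun j n => (n + 1)%:~R ^+ i + (- (n + 1)%:~R) ^+ i).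
  have [oi|ei] := boolP (odd i).
    by apply: wfun_ext (wfun_const 0) => j n; rewrite exprNn -signr_odd oi expr1 mulN1r subrr.
  have -> : i = (2 * i./2)%N by rewrite mul2n even_halfK.
  apply: wfun_ext (wfunM (wfun_const 2%:R) (wfunX i./2 hN2)) => j n.
  by rewrite !exprM sqrrN mulr_natl mulr2n.
apply: (@wfun_ext (fun j n => 2%:R^-1 * (\sum_(i < size P) \sum_(l < size P`_i)
    P`_i`_l * (n - 2 * j%:Z)%:~R ^+ l * ((n + 1)%:~R ^+ i + (- (n + 1)%:~R) ^+ i)))).
  move=> j n; have [e1 e2] := QE j n.
  apply: (mulfI half2); rewrite mulVKf // [RHS]mulr_natl [RHS]mulr2n.
  rewrite [X in _ = X + _]e1 [X in _ = _ + X]e2 !hP !peval2E.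
  rewrite -big_split /=; apply: eq_bigr => i _; rewrite -big_split /=.
  by apply: eq_bigr => l _; rewrite mulrDr.
apply: wfunM; first exact: wfun_const.
apply: wfun_sum => i; apply: wfun_sum => l; apply: wfunM; last exact: hN.
by apply: wfunM; [exact: wfun_const | exact: wfunX].
Qed.

End PolynomialFunctions.

(** * Regularity of psi and membership of [X^+, X^-] - H in [K0] *)

Section Regularity.
Variable k : fieldType.
Hypothesis char0 : [pchar k] =i pred0.
Variable psi : nat -> int -> pser k.
Hypothesis hpsi : colouring psi.
Local Notation psi0 := (psi0 psi).
Local Notation actL := (actL psi).

Lemma actL_H n j i l x : actL n j i l (Flmul GH x) = (n - 2 * i%:Z)%:~R * actL n j i l x.
Proof.
rewrite /actL lin_lmul -linMl; apply: (@eq_lin k k^o) => w.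
by rewrite /Wc word_act_H word_act_H2; case: eqP => [->|_]; rewrite ?mulr0.
Qed.

Lemma actL_XmXp n j i l x : actL n j i l (Flmul GXm (Flmul GXp x)) =
  \sum_(s < l.+1) psi0 i n s * actL n j i (l - s)%N x.
Proof.
rewrite /actL !lin_lmul.
under [RHS]eq_bigr do rewrite -linMl.
rewrite -(@lin_sum k k^o 'I_l.+1 _ (fun s w => psi0 i n s * Wc psi n w j i (l - s)%N)).
apply: (@eq_lin k k^o) => w.
rewrite /Wc word_act_Xm2 word_act_Xm1 word_act_Xp2 word_act_Xp1.
set t := (word_act _ _ _ _).2; set c := (word_act _ _ _ _).1.
have [->|ti] := eqVneq t i; last first.
  rewrite [RHS]big1 => [|s _]; last by rewrite mulr0.
  by case: t ti => [|t] ti /=; rewrite ?(negPf ti) // psmul_eq0l // if_same.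
case: i => [|i] /=; last by rewrite eqxx.
by rewrite big1 // => s _; rewrite mul0r.
Qed.

Definition diagonal (x : Fel k) (G : nat -> nat -> int -> k) :=
  forall n j i l, actL n j i l x = if j == i then G l j n else 0.

(** A polynomial in H and X^- X^+ realises [g] modulo h. As X^- X^+ acts by the full series psi,
    terms of higher order appear; keeping them in [wfun] is what allows iteration. *)
Lemma wfun_lift g : (forall m, wfun (fun j n => psi0 j n m)) -> wfun g ->
  exists x G, [/\ diagonal x G, forall j n, G 0%N j n = g j n & forall m, wfun (G m)].
Proof.
move=> hp; elim=> {g} [c|g1 g2 _ [x1 [G1 [d1 e1 w1]]] _ [x2 [G2 [d2 e2 w2]]]
  |g1 _ [x1 [G1 [d1 e1 w1]]]|g1 _ [x1 [G1 [d1 e1 w1]]]|g1 g2 e _ [x1 [G1 [d1 e1 w1]]]].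
- exists [:: (c, [::])], (fun l _ _ => if l is 0 then c else 0); split=> //; last first.
    by case=> [|m]; exact: wfun_const.
  move=> n j i l; rewrite /actL lin_cons lin_nil addr0 /Wc /=.
  by case: eqP => _; rewrite ?scaler0 //; case: l => [|l] /=; rewrite ?scaler0 // /GRing.scale /= mulr1.
- exists (x1 ++ x2), (fun l j n => G1 l j n + G2 l j n); split=> [n j i l|j n|m].
  + by rewrite actL_cat d1 d2; case: eqP; rewrite ?addr0.
  + by rewrite e1 e2.
  + exact: wfunD.
- exists (Flmul GH x1), (fun l j n => (n - 2 * j%:Z)%:~R * G1 l j n); split=> [n j i l|j n|m].
  + by rewrite actL_H d1; case: eqP => [->|]; rewrite ?mulr0.
  + by rewrite e1.
  + exact: wfun_H.
- exists (Flmul GXm (Flmul GXp x1)), (fun l j n => \sum_(s < l.+1) psi0 j n s * G1 (l - s)%N j n).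
  split=> [n j i l|j n|m].
  + rewrite actL_XmXp; case: eqP => [<-|ji].
      by apply: eq_bigr => s _; rewrite d1 eqxx.
    by rewrite big1 // => s _; rewrite d1; case: eqP => //; rewrite mulr0.
  + by rewrite big_ord1 subn0 e1 (psi0_0 hpsi).
  + by apply: wfun_sum => s; exact: wfunM.
- by exists x1, G1; split=> // j n; rewrite e1 e.
Qed.

Lemma wfun_series (G0 : nat -> nat -> int -> k) :
  (forall m, wfun (fun j n => psi0 j n m)) -> (forall m, wfun (G0 m)) ->
  exists z, forall n j p i, act_basis psi n z j p i = if j == i then G0 p j n else 0.
Proof.
move=> hp hG0; pose S := {G : nat -> nat -> int -> k | forall m, wfun (G m)}.
(* One approximation step: G is the action of [xG.1] plus h times [xG.2]. *)
have /choice[step hstep] : forall G : S, exists xG : Fel k * S, diagonal xG.1 (fun l j n =>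
    if l is l'.+1 then sval G l j n - sval xG.2 l' j n else sval G 0%N j n).
  move=> [G hG]; have [x [G1 [d1 e1 w1]]] := wfun_lift hp (hG 0%N).
  have w' m : wfun (fun j n => G m.+1 j n - G1 m.+1 j n) by exact: wfunB.
  exists (x, exist _ _ w') => n j i l; rewrite d1 /=; case: l => [|l]; first by rewrite e1.
  by rewrite opprB addrC subrK.
pose st m := iter m (fun G => (step G).2) (exist _ G0 hG0 : S).
exists (fun m => (step (st m)).1) => n j p i.
rewrite act_basisE.
(* The starting stage is generalised because the tail of the sum is the same sum started one stage
   later. *)
suff H m : \sum_(l < p.+1) actL n j i (p - l)%N (step (st (m + l)%N)).1 =
    if j == i then sval (st m) p j n else 0 by exact: (H 0%N).
elim: p m => [|p IH] m.
  by rewrite big_ord1 subn0 addn0 hstep.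
rewrite big_ord_recl addn0 subn0.
under eq_bigr => l _ do rewrite lift0 subSS -addSnnS.
rewrite IH hstep; case: eqP => _; last by rewrite addr0.
by rewrite [st m.+1]iterS subrK.
Qed.

Lemma actL_rel_pm n j i l : actL n j i l (rel_pm k [::]) =
  if j == i then psi0 j.+1 n l - psi0 j n l - (if l is 0 then (n - 2 * j%:Z)%:~R else 0) else 0.
Proof.
rewrite /actL /rel_pm !lin_cons lin_nil addr0 /Wc.
rewrite !(word_act_H, word_act_H2, word_act_Xp2, word_act_Xp1, word_act_Xm2, word_act_Xm1).
have h f : psmul f (psC 1) l = f l.
  rewrite /psmul (bigD1 ord_max) //= subnn mulr1 big1 ?addr0 // => s sl.
  case: (l - s)%N (subn_eq0 l s) => [/esym|d _]; last by rewrite mulr0.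
  move=> ls; case/eqP: sl; apply: val_inj => /=; apply/eqP.
  by rewrite eqn_leq ls -ltnS ltn_ord.
have h' f : psmul f (psmul (psC 1) (psC 1)) l = f l.
  by rewrite -[RHS]h; apply: eq_psmul => // s _; rewrite psmul_psCl mul1r.
rewrite /= h h'.
case: (eqVneq j i) => [->|ji].
  case: i => [|i] /=.
    rewrite /GRing.scale /=; case: l {h h'} => [|l] /=; rewrite ?if_same; ring.
  by rewrite ?eqxx /GRing.scale /=; case: l {h h'} => [|l] /=; ring.
rewrite !scaler0 add0r addr0; case: j ji => [|j] ji /=; first by rewrite if_same scaler0.
by rewrite (negPf ji) scaler0.
Qed.

(** By (C1), r = [X^+, X^-] - H acts by zero modulo h, hence as h times a diagonal series, whose
    coefficients sit one order higher in psi. If [z] realises that series, r - h z annihilates. *)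
Lemma regular_K0_pm : regular psi -> forall w, K0 psi (rel_pm k w).
Proof.
move=> reg w; have hp m := regular_wfun char0 hpsi (reg m).
have [|z hz] := wfun_series (G0 := fun m j n => psi0 j.+1 n m.+1 - psi0 j n m.+1) hp.
  by move=> m; exact: (wfunB (wfun_shift (hp m.+1)) (hp m.+1)).
apply: (K0_rmul (x := rel_pm k [::]) w).
exists (Fh_add (Fh_const (rel_pm k [::])) (Fh_opp (Fh_shift z))); last first.
  by move=> u.
move=> n j p i; rewrite act_add act_opp act_const act_shift actL_rel_pm.
case: p => [|p]; last by rewrite hz; case: eqP => _; rewrite subr0 ?subrr.
rewrite subr0 !(psi0_0 hpsi) -!rmorphB /=; case: eqP => // _.
rewrite (_ : _ - _ = 0) //.
by rewrite (_ : j.+1%:Z = j%:Z + 1); [ring|lia].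
Qed.

(** The integer [d] is the shift of index caused by the word. The alternative of zero coefficients
    covers paths that fall below b_0, where the index is truncated. *)
Lemma word_polyfun m : (forall l, (l < m)%N -> regular_at psi l) ->
  forall w, exists d : int,
  (forall n j, (forall l, (word_act psi n w j).1 l = 0) \/
     (word_act psi n w j).2%:Z = j%:Z + d) /\
  (forall l, (l < m)%N -> exists2 g, polyfun g &
     forall n j, (word_act psi n w j).1 l = g j%:R n%:~R).
Proof.
move=> reg; elim=> [|a w [d [hd hg]]].
  exists 0; split; first by move=> n j; right; rewrite addr0.
  by move=> l _; exists (fun _ _ => psC 1 l) => //; exact: polyfun_const.
case: a.
- exists d; split=> [n j|l lm].
    rewrite word_act_H2; case: (hd n j) => [h|]; [left=> l | by right].
    by rewrite word_act_H h mulr0.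
  have [g pg gE] := hg l lm; exists (fun x y => (y - 2%:R * (x + d%:~R)) * g x y).
    apply: polyfunM => //; apply: polyfunB; first exact: polyfun_snd.
    apply: polyfunM; first exact: polyfun_const.
    by apply: polyfunD; [exact: polyfun_fst | exact: polyfun_const].
  move=> n j; rewrite word_act_H gE; case: (hd n j) => [/(_ l)|->].
    by rewrite gE => ->; rewrite !mulr0.
  by rewrite !(rmorphB, rmorphM, rmorphD).
- exists (d + 1); split=> [n j|l lm].
    rewrite word_act_Xm2; case: (hd n j) => [h|h]; [left=> l | right].
      by rewrite word_act_Xm1.
    by rewrite addrA -h; lia.
  by have [g pg gE] := hg l lm; exists g => // n j; rewrite word_act_Xm1.
- exists (d - 1); split=> [n j|l lm].
    rewrite word_act_Xp2; case: (hd n j) => [h|h]; first by left=> l; rewrite word_act_Xp1 psmul_eq0r.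
    case t0: (word_act psi n w j).2 => [|t]; [left=> l | right].
      by rewrite word_act_Xp1 t0 psmul_eq0l.
    by rewrite addrA -h t0 /=; lia.
  have /choice[g hgs] : forall s : 'I_l.+1, exists g, polyfun g /\
      forall n j, (word_act psi n w j).1 s = g j%:R n%:~R.
    move=> s; have [|g pg gE] := hg s; last by exists g.
    by apply: leq_ltn_trans lm; rewrite -ltnS.
  have /choice[q hqs] : forall s : 'I_l.+1, exists q, polyfun q /\
      forall (c : nat) (n : int), psi0 c n s = q c%:R n%:~R.
    move=> s; have [|q pq qE] := regular_psi0 char0 hpsi (m := s); last by exists q.
    by apply: reg; apply: leq_ltn_trans lm; rewrite -ltnS.
  exists (fun x y => \sum_(s < l.+1) q s (x + d%:~R) y * g (rev_ord s) x y).
    apply: polyfun_sum => s; have [pq _] := hqs s; have [pg _] := hgs (rev_ord s).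
    apply: polyfunM => //; apply: (@polyfun_comp _ (q s)) => //; last exact: polyfun_snd.
    by apply: polyfunD; [exact: polyfun_fst | exact: polyfun_const].
  move=> n j; rewrite word_act_Xp1 /psmul; apply: eq_bigr => s _.
  have [_ qE] := hqs s; have [_ gE] := hgs (rev_ord s).
  have -> : (l - s)%N = rev_ord s by rewrite /= subSS.
  rewrite gE; case: (hd n j) => [/(_ (rev_ord s))|h].
    by rewrite gE => ->; rewrite !mulr0.
  by rewrite qE -[X in q s X]/((word_act psi n w j).2%:Z%:~R) h rmorphD.
Qed.

(** Only words of index shift zero contribute to a diagonal coefficient, uniformly in n and j. *)
Lemma actL_polyfun m x l : (forall l, (l < m)%N -> regular_at psi l) -> (l < m)%N ->
  exists2 g, polyfun g & forall n j, actL n j j l x = g j%:R n%:~R.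
Proof.
move=> reg lm; elim: x => [|[c w] x [g pg gE]].
  exists (fun _ _ => 0); first exact: polyfun_const.
  by move=> n j; rewrite actL_nil.
have [d [hd hg]] := word_polyfun reg w; have [g' pg' gE'] := hg l lm.
exists (fun x y => c * (if d == 0 then g' x y else 0) + g x y).
  apply: polyfunD => //; apply: polyfunM; first exact: polyfun_const.
  by case: eqP => _ //; exact: polyfun_const.
move=> n j; rewrite /actL lin_cons -/(actL n j j l x) gE /=; congr (_ + _).
rewrite /Wc gE' /GRing.scale /=; congr (_ * _); case: (hd n j) => [/(_ l)|h].
  by rewrite gE' => ->; rewrite !if_same.
congr (if _ then _ else _); apply/eqP/eqP => [e|e]; first by move: h; rewrite e; lia.
by move: h; rewrite e; lia.
Qed.

Lemma K0_pm_regular : K0 psi (rel_pm k [::]) -> regular psi.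
Proof.
move=> [y ay yr] m; elim/ltn_ind: m => m reg.
(* The factor h^(l+1) of [y l.+1] leaves only its action at order m - l - 1 < m, polynomial by
   induction. *)
have /choice[g hg] : forall l : 'I_m, exists g, polyfun g /\
    forall n j, actL n j j (m - l.+1)%N (y l.+1) = g j%:R n%:~R.
  move=> l; have [|g pg gE] := actL_polyfun (y l.+1) (l := (m - l.+1)%N) reg; last by exists g.
  by have := ltn_ord l; lia.
(* [R] is the increment psi^(j+1)(n) - psi^j(n) at order m, to which H contributes only for m = 0;
   as psi^0 = 0, psi^c is the sum of the increments over j < c. *)
pose R (x z : k) := (if m is 0 then z - 2%:R * x else 0) - \sum_(l < m) g l x z.
have pR : polyfun R.
  apply: polyfunB; last by apply: polyfun_sum => l; case: (hg l).
  case: {reg g hg R}m => [|m]; last exact: polyfun_const.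
  exact: (polyfunB (polyfun_snd k) (polyfunM (polyfun_const 2%:R) (polyfun_fst k))).
have hR (j : nat) (n : int) : psi0 j.+1 n m = psi0 j n m + R j%:R n%:~R.
  have := ay n j m j; rewrite act_basisE big_ord_recl subn0 (actL_eq _ _ _ _ _ yr) actL_rel_pm eqxx.
  under eq_bigr => l _ do rewrite lift0 (hg l).2.
  move=> h; apply/eqP; rewrite -subr_eq0 -h /R; apply/eqP.
  have -> : (if m is 0 then n%:~R - 2%:R * j%:R else 0) =
      (if m is 0 then (n - 2 * j%:Z)%:~R else 0) :> k.
    by case: {reg g hg R pR h}m => //; rewrite rmorphB rmorphM.
  by rewrite !opprD opprK !addrA.
have [g0 [P hP] PE] := polyfun_partial_sum char0 pR; exists P => c n c0.
rewrite -hP -PE; have -> : psi c n m = psi0 c n m by case: c c0.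
by elim: c {c0} => [|c IH]; rewrite ?big_ord0 // hR big_ord_recr /= IH.
Qed.

End Regularity.

(** * Formal deformations of U(sl_2) and regularity *)

Section Deformation.
Variable k : fieldType.
Hypothesis char0 : [pchar k] =i pred0.
Variable psi : nat -> int -> pser k.
Hypothesis hpsi : colouring psi.
Variables (A : algType k) (e f hh : A).
Hypothesis hA : is_Usl2 e f hh.
Local Notation ev := (ev e f hh).
Local Notation gA := (gA e f hh).

Lemma ev_Fh_mul (x y : Fh k) : ev (Fh_mul x y 0%N) = ev (x 0%N) * ev (y 0%N).
Proof. by rewrite -ev_mul /Fh_mul /= cats0. Qed.

Lemma in_hFh_sub (x y : Fh k) :
  in_hFh (Fh_add x (Fh_opp y)) <-> Feq (x 0%N) (y 0%N).
Proof.
split=> h w; last by rewrite Fcoef_cat (Fcoef_opp (y 0%N)) h subrr.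
by apply/eqP; rewrite -subr_eq0 -(Fcoef_opp (y 0%N)) -Fcoef_cat; apply/eqP/h.
Qed.

Section TopologicallyFree.
Hypothesis ker_ev : forall x, ev x = 0 -> K0 psi x.

Lemma ordered_section : exists s : A -> Fel k, forall a, NF (s a) /\ ev (s a) = a.
Proof.
suff /choice[s hs] : forall a, exists x : Fel k, NF x /\ ev x = a by exists s.
move=> a; have [x <-] := ev_surj hA a.
by have [y ny ->] := ev_straighten hA x; exists y.
Qed.

(** V0 is A itself: each class modulo the annihilator has exactly one sequence v whose ordered
    representatives form a series [S v] in it. [Phi] reads off v, and its linearity follows from
    uniqueness. *)
Lemma topologically_free : topologically_free_Uhpsi psi.
Proof.
have [s hs] := ordered_section.
have sE x a : NF x -> ev x = a -> Feq x (s a).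
  move=> nx xa w; have [ns es] := hs a.
  apply/eqP; rewrite -subr_eq0 -Fcoef_opp -Fcoef_cat; apply/eqP.
  apply: (NF_ev0 char0 hpsi hA); first by rewrite NF_cat NF_opp nx.
  by rewrite /ev lin_cat lin_opp -!/(ev _) xa es subrr.
have sD a b w : Fcoef (s (a + b)) w = Fcoef (s a) w + Fcoef (s b) w.
  have [na ea] := hs a; have [nb eb] := hs b.
  rewrite -Fcoef_cat; apply/esym/sE; first by rewrite NF_cat na.
  by rewrite /ev lin_cat -!/(ev _) ea eb.
have sZ c a w : Fcoef (s (c *: a)) w = c * Fcoef (s a) w.
  have [na ea] := hs a; rewrite -Fcoef_scale; apply/esym/sE; first by rewrite NF_scale.
  by rewrite /ev lin_scale -!/(ev _) ea.
have s0 w : Fcoef (s 0) w = 0 by rewrite -(scale0r 0) sZ mul0r.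
have sB a b w : Fcoef (s (a - b)) w = Fcoef (s a) w - Fcoef (s b) w.
  by rewrite sD -scaleN1r sZ mulN1r.
pose S (v : nat -> A) : Fh k := fun m => s (v m).
(* The constant term gives v_0 = 0; then [S v] is h times the series of the shifted sequence, and h
   can be cancelled in the action. *)
have S_inj v : annih psi (S v) -> forall m, v m = 0.
  move=> av m; elim: m v av => [|m IH] v av;
    have v0 : v 0%N = 0 by rewrite -[LHS](hs _).2; exact: (annih_ev char0 hpsi hA av).
    by [].
  apply: (IH (fun m => v m.+1)) => n j p i.
  rewrite -(av n j p.+1 i) -[LHS](act_shift psi n _ j p.+1); apply: act_eq => -[|l] w //.
  by rewrite /S v0 s0 Fcoef_nil.
(* Decompose x as s(ev x_0) + y + h x' with y annihilating; iterating on x' yields the successive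
   entries of v. *)
have /choice[step hstep] : forall x : Fh k, exists x' : Fh k, exists2 y, annih psi y &
    forall m, Feq (x m) (Fh_add (Fh_const (s (ev (x 0%N)))) (Fh_add y (Fh_shift x')) m).
  move=> x; have [y ay yE] : K0 psi (x 0%N ++ Fopp (s (ev (x 0%N)))).
    by apply: ker_ev; rewrite /ev lin_cat lin_opp -!/(ev _) (hs _).2 subrr.
  exists (fun m => x m.+1 ++ Fopp (y m.+1)), y => // -[|m] w.
    by rewrite !(Fcoef_cat, Fcoef_nil) yE !FcoefD; ring.
  by rewrite !(Fcoef_cat, Fcoef_nil, Fcoef_opp); ring.
have S_surj x : exists v, annih psi (Fh_add x (Fh_opp (S v))).
  exists (fun m => ev (iter m step x 0%N)) => n j p i.
  rewrite act_add act_opp; apply/eqP; rewrite subr_eq0; apply/eqP; rewrite [RHS]act_basisE.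
  elim: p x => [|p IH] x; have [y ay /(act_eq _ _ _ _) ->] := hstep x;
    rewrite !act_add act_const act_shift ay add0r.
    by rewrite big_ord1 addr0.
  rewrite big_ord_recl subn0 IH; congr (_ + _); apply: eq_bigr => l _.
  by rewrite lift0 subSS /S iterSr.
have [Phi hPhi] := choice S_surj.
have Phi_uniq x v : annih psi (Fh_add x (Fh_opp (S v))) -> forall m, Phi x m = v m.
  move=> av m; apply/eqP; rewrite -subr_eq0; apply/eqP.
  apply: (S_inj (fun m => Phi x m - v m)).
  apply: eq_annih (annih_add av (annih_opp (hPhi x))) => l w.
  rewrite !Fcoef_cat !(Fcoef_opp (S _ l)) (Fcoef_opp (x l ++ _)) Fcoef_cat.
  by rewrite (Fcoef_opp (S _ l)) /S sB; ring.
exists A, Phi; split.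
- move=> x y m; apply: (Phi_uniq _ (fun m => Phi x m + Phi y m)).
  apply: eq_annih (annih_add (hPhi x) (hPhi y)) => l w.
  by rewrite !Fcoef_cat !(Fcoef_opp (S _ l)) /S sD; ring.
- move=> c x m; apply: (Phi_uniq _ (fun m => \sum_(i < m.+1) c i *: Phi x (m - i)%N)).
  apply: eq_annih (annih_psmul c (hPhi x)) => l w.
  rewrite Fcoef_psmul [RHS](Fcoef_cat (Fh_psmul c x l)) (Fcoef_opp (S _ l)) Fcoef_psmul /S.
  have -> : Fcoef (s (\sum_(i < l.+1) c i *: Phi x (l - i)%N)) w =
      \sum_(i < l.+1) c i * Fcoef (s (Phi x (l - i)%N)) w.
    elim/big_rec2: _ => [|i a b _ <-]; first exact: s0.
    by rewrite sD sZ.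
  rewrite -sumrB; apply: eq_bigr => i _.
  by rewrite (Fcoef_cat (x _)) (Fcoef_opp (s _)) mulrBr.
- move=> v; exists (S v); apply: Phi_uniq => n j p i.
  by rewrite act_add act_opp subrr.
- move=> x; split=> [x0|ax].
    apply: eq_annih (hPhi x) => m w.
    by rewrite Fcoef_cat (Fcoef_opp (S _ m)) /S x0 s0 subr0.
  apply: (Phi_uniq _ (fun=> 0)); apply: eq_annih ax => m w.
  by rewrite Fcoef_cat (Fcoef_opp (S _ m)) /S s0 subr0.
Qed.

End TopologicallyFree.

Lemma regular_deformation_aalg : regular psi -> deformation_aalg psi e f hh.
Proof.
move=> /(regular_K0_pm char0 hpsi)/(ev_K0 char0 hpsi hA) ker_ev.
split; first exact: topologically_free.
exists (fun x => ev (x 0%N)); split; try exact: ev_gen.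
split; first split.
- by move=> x y; rewrite /ev lin_cat.
- by move=> c x; rewrite /ev lin_scale.
- exact: ev_Fh_mul.
- exact: ev_one.
split=> [a|x].
  by have [x <-] := ev_surj hA a; exists (Fh_const x).
split=> [/ker_ev[y ay yx]|[y [ay /in_hFh_sub yx]]].
  by exists y; split=> //; apply/in_hFh_sub => w; rewrite yx.
by rewrite (ev_eq _ _ _ yx) (annih_ev char0 hpsi hA).
Qed.

Lemma deformation_kalg_regular : deformation_kalg psi A -> regular psi.
Proof.
move=> [_ [Phi [[PD PZ PM P1] [Psurj Pker]]]].
have PN x y : Phi (Fh_add x (Fh_scale (-1) y)) = Phi x - Phi y.
  by rewrite PD PZ scaleN1r.
(* The kernel of [Phi] consists of annihilators modulo h, whose constant terms evaluate to zero; so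
   evaluation factors through [Phi] as an endomorphism [pi] of A. *)
have wd x y : Phi x = Phi y -> ev (x 0%N) = ev (y 0%N).
  move=> /eqP; rewrite -subr_eq0 -PN => /eqP/Pker[z [az /in_hFh_sub/(ev_eq e f hh)]].
  rewrite (annih_ev char0 hpsi hA az) /ev lin_cat lin_scale scaleN1r.
  by move=> /eqP; rewrite subr_eq0 => /eqP.
have [sec hsec] := choice Psurj.
pose pi a := ev (sec a 0%N).
have piE x : pi (Phi x) = ev (x 0%N) by apply: wd.
have hpi : is_kalg_hom pi.
  split=> [a b|c a|a b|].
  - by rewrite -{1}(hsec a) -{1}(hsec b) -PD piE /ev lin_cat.
  - by rewrite -{1}(hsec a) -PZ piE /ev lin_scale.
  - by rewrite -{1}(hsec a) -{1}(hsec b) -PM piE ev_Fh_mul.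
  - by rewrite -{1}P1 piE; exact: ev_one.
have spi a : exists b, pi b = a.
  by have [x <-] := ev_surj hA a; exists (Phi (Fh_const x)); rewrite piE.
(* The relation evaluates to zero, so [pi] kills its image under [Phi]; injectivity of [pi] then
   makes it the constant term of an annihilator. *)
have : Phi (Fh_const (rel_pm k [::])) = 0.
  apply: (hopfian char0 hpsi hA hpi spi); rewrite piE /=.
  rewrite /ev /rel_pm !lin_cons lin_nil !wA_cons /wA big_nil !mulr1 /= addr0.
  by have [[_ _ <-] _] := hA; rewrite scale1r !scaleN1r addrA subrr.
move=> /Pker[y [ay /in_hFh_sub yr]]; apply: (K0_pm_regular char0 hpsi).
by exists y => // w; rewrite -yr.
Qed.
End Deformation.

Theorem mainTheorem7 (k : fieldType) (char0 : [pchar k] =i pred0)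
    (A : algType k) (e f hh : A) (hA : is_Usl2 e f hh)
    (psi : nat -> int -> pser k) (hpsi : colouring psi) :
  (regular psi <-> deformation_kalg psi A) /\
  (regular psi <-> deformation_aalg psi e f hh).
Proof.
have i_iii := regular_deformation_aalg char0 hpsi hA.
have ii_i := deformation_kalg_regular char0 hpsi hA.
have iii_ii : deformation_aalg psi e f hh -> deformation_kalg psi A.
  by move=> [tf [Phi [iso _ _ _]]]; split=> //; exists Phi.
by split; split=> [/i_iii|]; [move/iii_ii | move/ii_i | | move/iii_ii/ii_i].
Qed.
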